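(* Let $(X,d_X)$ and $(Y,d_Y)$ be uniformly locally finite metric spaces. If the quasi-local algebras $\mathrm{C}^*_{ql}(X)$ and $\mathrm{C}^*_{ql}(Y)$ are $^*$-isomorphic, then $X$ and $Y$ are bijectively coarsely equivalent.
   Context: A metric space $(X,d)$ is uniformly locally finite (u.l.f.) if $\sup_{x\in X}|B_r(x)|<\infty$ for every $r>0$. For $A\subseteq X$, $\chi_A$ denotes the orthogonal projection of $\ell_2(X)$ onto $\ell_2(A)$. An operator $a\in\mathcal B(\ell_2(X))$ is quasi-local if for every $\varepsilon>0$ there is $r>0$ such that $\|\chi_A a\chi_B\|<\varepsilon$ for all $A,B\subseteq X$ with $d(A,B)\ge r$; $\mathrm{C}^*_{ql}(X)$ denotes the $\mathrm{C}^*$-algebra of quasi-local operators. A map $f\colon X\to Y$ is coarse if for every $r>0$ there is $s>0$ with $d_X(x,x')\le r\Rightarrow d_Y(f(x),f(x'))\le s$; $f,g$ are close if $\sup_x d_Y(f(x),g(x))<\infty$; $f$ is a coarse equivalence if there is a coarse $g\colon Y\to X$ with $f\circ g$ close to $\mathrm{Id}_Y$ and $g\circ f$ close to $\mathrm{Id}_X$. Bijectively coarsely equivalent means there is a bijective coarse equivalence $X\to Y$. *)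

(* Defs.v *)
From mathcomp Require Import all_boot all_order all_algebra.
From mathcomp Require Import all_classical all_reals all_analysis.
From mathcomp Require Import Rstruct Rstruct_topology.
From mathcomp Require Import complex.
From Stdlib Require Import Reals.

Set Implicit Arguments.
Unset Strict Implicit.
Unset Printing Implicit Defensive.

Import Order.TTheory GRing.Theory Num.Theory.
Local Open Scope ring_scope.
Local Open Scope classical_set_scope.

Notation C := (R[i]).

Definition csqnorm (z : C) : R := (complex.Re z) ^+ 2 + (complex.Im z) ^+ 2.

Definition is_metric (X : Type) (d : X -> X -> R) : Prop :=
  (forall x y, 0 <= d x y) /\
  (forall x y, d x y = 0 <-> x = y) /\
  (forall x y, d x y = d y x) /\
  (forall x y z, d x z <= d x y + d y z).

(* sup_x |B_r(x)| < oo for every r > 0 (closed balls B_r(x) = {y | d x y <= r}):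
   there is a uniform bound N on the number of distinct points of any ball. *)
Definition ulf (X : eqType) (d : X -> X -> R) : Prop :=
  forall r : R, 0 < r -> exists N : nat, forall (x : X) (s : seq X),
    uniq s -> (forall y, y \in s -> d x y <= r) -> (size s <= N)%nat.

Definition coarse_map (X Y : Type) (dX : X -> X -> R) (dY : Y -> Y -> R)
  (f : X -> Y) : Prop :=
  forall r : R, 0 < r -> exists s : R, 0 < s /\
    forall x x', dX x x' <= r -> dY (f x) (f x') <= s.

Definition close_maps (X Y : Type) (dY : Y -> Y -> R) (f g : X -> Y) : Prop :=
  exists M : R, forall x, dY (f x) (g x) <= M.

Definition coarse_equivalence (X Y : Type) (dX : X -> X -> R)
  (dY : Y -> Y -> R) (f : X -> Y) : Prop :=
  coarse_map dX dY f /\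
  exists g : Y -> X, coarse_map dY dX g /\
    close_maps dY (f \o g) (fun y => y) /\ close_maps dX (g \o f) (fun x => x).

Definition bij_coarse_equiv (X Y : Type) (dX : X -> X -> R)
  (dY : Y -> Y -> R) : Prop :=
  exists f : X -> Y, bijective f /\ coarse_equivalence dX dY f.

Section L2.
Variable X : choiceType.

Definition l2norm2 (v : X -> C) : \bar R :=
  (\esum_(x in [set: X]) (csqnorm (v x))%:E)%E.

Definition is_l2 (v : X -> C) : Prop := (l2norm2 v < +oo)%E.

(* Operators are represented as maps on all functions X -> C; only their
   behaviour on l_2(X) matters (see op_eq). *)
Definition Op := (X -> C) -> (X -> C).

Definition op_eq (a b : Op) : Prop := forall v, is_l2 v -> a v = b v.

Definition op_add (a b : Op) : Op := fun v x => a v x + b v x.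
Definition op_scale (c : C) (a : Op) : Op := fun v x => c * a v x.
Definition op_mul (a b : Op) : Op := fun v => a (b v).

Definition is_bounded (a : Op) : Prop :=
  (forall v, is_l2 v -> is_l2 (a v)) /\
  (forall u v, is_l2 u -> is_l2 v ->
     a (fun x => u x + v x) = (fun x => a u x + a v x)) /\
  (forall (c : C) v, is_l2 v -> a (fun x => c * v x) = (fun x => c * a v x)) /\
  (exists M : R, forall v, is_l2 v -> (l2norm2 (a v) <= (M ^+ 2)%:E * l2norm2 v)%E).

Definition opnorm_lt (a : Op) (eps : R) : Prop :=
  exists e : R, 0 <= e /\ e < eps /\
    forall v, is_l2 v -> (l2norm2 (a v) <= (e ^+ 2)%:E * l2norm2 v)%E.

Definition chi (A : set X) : Op := fun v x => if asbool (A x) then v x else 0.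

Definition delta (y : X) : X -> C := fun x => if x == y then 1 else 0.

(* b is the adjoint a^* of a: <a delta_y, delta_x> = <delta_y, b delta_x>
   for all basis vectors (inner product linear in the first variable). *)
Definition is_adjoint (a b : Op) : Prop :=
  forall x y : X, a (delta y) x = conjc (b (delta x) y).

Definition quasi_local (d : X -> X -> R) (a : Op) : Prop :=
  is_bounded a /\
  forall eps : R, 0 < eps -> exists r : R, 0 < r /\
    forall A B : set X, (forall x y, A x -> B y -> r <= d x y) ->
      opnorm_lt (op_mul (chi A) (op_mul a (chi B))) eps.

End L2.

Arguments op_eq {X}.
Arguments op_add {X}.
Arguments op_scale {X}.
Arguments op_mul {X}.
Arguments is_adjoint {X}.

(* phi : C*_{ql}(X) -> C*_{ql}(Y) is a *-isomorphism.  Operators are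
   identified when they agree on l_2 (op_eq); phi must be well defined,
   map C*_{ql}(X) into C*_{ql}(Y), be bijective, and preserve the
   *-algebra operations. *)
Definition star_iso_ql (X Y : choiceType) (dX : X -> X -> R) (dY : Y -> Y -> R)
  (phi : Op X -> Op Y) : Prop :=
  (forall a, quasi_local dX a -> quasi_local dY (phi a)) /\
  (forall a b, quasi_local dX a -> quasi_local dX b ->
     op_eq a b -> op_eq (phi a) (phi b)) /\
  (forall a b, quasi_local dX a -> quasi_local dX b ->
     op_eq (phi a) (phi b) -> op_eq a b) /\
  (forall b, quasi_local dY b -> exists a, quasi_local dX a /\ op_eq (phi a) b) /\
  (forall a b, quasi_local dX a -> quasi_local dX b ->
     op_eq (phi (op_add a b)) (op_add (phi a) (phi b))) /\
  (forall (c : C) a, quasi_local dX a ->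
     op_eq (phi (op_scale c a)) (op_scale c (phi a))) /\
  (forall a b, quasi_local dX a -> quasi_local dX b ->
     op_eq (phi (op_mul a b)) (op_mul (phi a) (phi b))) /\
  (forall a b, quasi_local dX a -> quasi_local dX b -> is_adjoint a b ->
     is_adjoint (phi a) (phi b)).

(* Main.v *)
(** A *-isomorphism is implemented by a unitary matrix U, because it maps matrix units to
   matrix units of rank one. A gliding hump argument makes the cut-offs U^* chi_B U, for
   B a subset of Y, quasi-local uniformly in B, and likewise U chi_A U^*.

   Inserting random signs in these cut-offs has two consequences. First, U^* (sigma U delta_x)
   has small entries if U delta_x does, while most of its mass lies in a ball around x with
   boundedly many points; so every column, and by symmetry every row, has an entry of modulus
   bounded below, and this defines f : X -> Y and g : Y -> X. Second, the average over sigma of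
   U^* sigma U composed with the corresponding signs on g(Y) isolates the entries of U itself,
   so that chi_D U chi_A is small as soon as g(D) is far from A.

   Hence U restricted to l_2(A), followed by the projection to the points y with g(y) near A,
   is injective, which is Hall's condition. This yields an injection X -> Y close to f and,
   symmetrically, one Y -> X close to g; the Schroeder-Bernstein construction glues them to a
   bijection close to f, and f is a coarse equivalence. *)
From Stdlib Require Import Reals.
Require Import Defs.
From mathcomp Require Import all_boot all_order all_algebra.
From mathcomp Require Import all_classical all_reals all_analysis.
From mathcomp Require Import Rstruct Rstruct_topology.
From mathcomp Require Import complex finmap.
From mathcomp Require Import lra ring.
Set Implicit Arguments.
Unset Strict Implicit.
Unset Printing Implicit Defensive.
Import Order.TTheory GRing.Theory Num.Theory.
Local Open Scope fset_scope.
Local Open Scope ring_scope.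

(** Quasi-locality of U^* chi_B U for each B separately does not suffice: the sign patterns inserted
    later depend on the point and on the finite sets under study, so one radius must serve all B at
    once. Finite B are enough for this, since signs on a finite set split it into two cut-offs and
    all estimates are made on finite subsets.

    That the bijection is coarse in both directions has a separate source. For r > 0 some
    quasi-local operator a on Y has entry 1 at every pair at distance at most r. Its image under the
    inverse isomorphism is quasi-local, and the coefficient of that image between the rows of the
    unitary at y and y' is again this entry. A row is concentrated around any point where it has a
    large entry, so such points for y and y' cannot be far apart when y and y' are close.

    The inverse isomorphism gets an implementing matrix V of its own, which agrees with U^* only up
    to a phase. The two are therefore compared only through moduli and through products of an entry
    with a conjugate entry. *)

Local Notation "z ^*" := (conjc z) : ring_scope.
Local Notation rc x := (real_complex _ x).

(** * Complex numbers and finite sums *)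

Section ComplexModulus.
Variable R : realType.
Local Notation C := (R[i]).
Implicit Types z w : C.

(** [csqnorm] over an arbitrary [realType]; at [R] the two are convertible. *)
Definition csq z : R := complex.Re z ^+ 2 + complex.Im z ^+ 2.

Lemma csq_ge0 z : 0 <= csq z.
Proof. by rewrite addr_ge0 ?sqr_ge0. Qed.

Lemma csq_eq0 z : csq z = 0 -> z = 0.
Proof.
move/eqP; rewrite paddr_eq0 ?sqr_ge0// !sqrf_eq0 => /andP[/eqP h1 /eqP h2].
by case: z h1 h2 => a b /= -> ->.
Qed.

Lemma csq0 : csq (0 : C) = 0.
Proof. by rewrite /csq /= !expr2 !mul0r addr0. Qed.

Lemma csq1 : csq (1 : C) = 1.
Proof. by rewrite /csq /= !expr2 mul0r addr0 mulr1. Qed.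

Lemma csqM z w : csq (z * w) = csq z * csq w.
Proof. by case: z w => [a b] [c d]; rewrite /csq /=; ring. Qed.

Lemma csqJ z : csq z^* = csq z.
Proof. by case: z => [a b]; rewrite /csq /= sqrrN. Qed.

Lemma csqN z : csq (- z) = csq z.
Proof. by case: z => [a b]; rewrite /csq /= !sqrrN. Qed.

Lemma mulJc z : z^* * z = rc (csq z).
Proof.
case: z => [a b]; apply/eqP; rewrite eq_complex /csq /=.
by apply/andP; split; apply/eqP; ring.
Qed.

Lemma mulcJ z : z * z^* = rc (csq z).
Proof. by rewrite mulrC mulJc. Qed.

Lemma csq_real (x : R) : csq (rc x) = x ^+ 2.
Proof. by rewrite /csq /= !expr2 !mul0r addr0. Qed.

Definition md (z : C) : R := Num.sqrt (csq z).

Lemma md_ge0 z : 0 <= md z. Proof. exact: sqrtr_ge0. Qed.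
Lemma md_sqr z : md z ^+ 2 = csq z.
Proof. by rewrite sqr_sqrtr// csq_ge0. Qed.
Lemma md0 : md (0 : C) = 0. Proof. by rewrite /md csq0 sqrtr0. Qed.
Lemma mdM z w : md (z * w) = md z * md w.
Proof. by rewrite /md csqM sqrtrM// csq_ge0. Qed.
Lemma mdJ z : md z^* = md z. Proof. by rewrite /md csqJ. Qed.
Lemma mdN z : md (- z) = md z. Proof. by rewrite /md csqN. Qed.
Lemma md_norm z : `|z| = rc (md z).
Proof. by rewrite normc_def. Qed.
Lemma md_eq0 z : md z = 0 -> z = 0.
Proof. by move=> h; apply: csq_eq0; rewrite -md_sqr h expr0n. Qed.
Lemma mdD z w : md (z + w) <= md z + md w.
Proof. by rewrite -lecR rmorphD /= -!md_norm ler_normD. Qed.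
Lemma mdB z w : md (z - w) <= md z + md w.
Proof. by rewrite -(mdN w) mdD. Qed.
Lemma md_rc (x : R) : md (rc x) = `|x|.
Proof. by rewrite /md csq_real sqrtr_sqr. Qed.
Lemma Re_md z : complex.Re z <= md z.
Proof.
apply: le_trans (ler_norm _) _; rewrite -sqrtr_sqr ler_wsqrtr//.
by rewrite /csq lerDl sqr_ge0.
Qed.
Lemma md_sum (I : Type) (s : seq I) (P : pred I) (F : I -> C) :
  md (\sum_(i <- s | P i) F i) <= \sum_(i <- s | P i) md (F i).
Proof.
elim/big_ind2 : _ => [|x1 x2 y1 y2 h1 h2|//]; first by rewrite md0.
by apply: le_trans (mdD _ _) _; apply: lerD.
Qed.

Lemma Re_sum (I : Type) (s : seq I) (P : pred I) (F : I -> C) :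
  complex.Re (\sum_(i <- s | P i) F i) = \sum_(i <- s | P i) complex.Re (F i).
Proof. 
apply: (big_ind2 (fun z r => complex.Re z = r)) => // x r y t <- <-.
by case: x y => [a b] [c d].
Qed.

Lemma conj_sum (I : Type) (s : seq I) (P : pred I) (F : I -> C) :
  (\sum_(i <- s | P i) F i)^* = \sum_(i <- s | P i) (F i)^*.
Proof. by rewrite rmorph_sum. Qed.

Lemma csq_addl z w : csq (z + w) <= 2 * csq z + 2 * csq w.
Proof.
case: z w => [a b] [c d]; rewrite /csq /=.
have := sqr_ge0 (a - c); have := sqr_ge0 (b - d); lra.
Qed.

Lemma conjM z w : (z * w)^* = z^* * w^*.
Proof. exact: rmorphM. Qed.

Lemma conj_fix_real z : z = z^* -> z = rc (complex.Re z).
Proof.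
move=> /(congr1 (@complex.Im R)); case: z => a b /= h.
by congr Complex; lra.
Qed.

End ComplexModulus.

Definition n2 (R : realType) (X : Type) (s : seq X) (v : X -> R[i]) : R := \sum_(x <- s) csq (v x).
Definition nm (R : realType) (X : Type) (s : seq X) (v : X -> R[i]) : R := Num.sqrt (n2 s v).

Section FiniteNorms.
Variables (R : realType) (X : Type).
Local Notation C := (R[i]).
Implicit Types (s : seq X) (u v w : X -> C).

Lemma n2_ge0 s v : 0 <= n2 s v.
Proof. by apply: sumr_ge0 => x _; exact: csq_ge0. Qed.
Lemma nm_ge0 s v : 0 <= nm s v. Proof. exact: sqrtr_ge0. Qed.
Lemma nm_sqr s v : nm s v ^+ 2 = n2 s v.
Proof. by rewrite sqr_sqrtr// n2_ge0. Qed.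

Lemma n2_add s u v : n2 s (fun x => u x + v x) <= 2 * n2 s u + 2 * n2 s v.
Proof.
rewrite /n2 !mulr_sumr -big_split /=; apply: ler_sum => x _; exact: csq_addl.
Qed.

Lemma n2_scale s c v : n2 s (fun x => c * v x) = csq c * n2 s v.
Proof. by rewrite /n2 mulr_sumr; apply: eq_bigr => x _; rewrite csqM. Qed.

(** Bilinear, so callers supply conjugations. Induction on the list: the cross term is absorbed by
    2ab <= a^2 + b^2. *)
Lemma cauchy_schwarz s u v :
  md (\sum_(x <- s) u x * v x) <= nm s u * nm s v.
Proof.
rewrite /md /nm -sqrtrM ?n2_ge0// ler_wsqrtr//.
elim: s => [|x s IH]; first by rewrite /n2 !big_nil csq0 mul0r.
rewrite /n2 !big_cons -!/(n2 _ _).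
set S := \sum_(_ <- _) _ in IH *; set A := n2 s u in IH *; set B := n2 s v in IH *.
have A0 : 0 <= A := n2_ge0 _ _; have B0 : 0 <= B := n2_ge0 _ _.
have a0 := csq_ge0 (u x); have b0 := csq_ge0 (v x).
have e : csq (u x * v x + S) = csq (u x * v x) + csq S
    + 2 * complex.Re (u x * v x * S^*).
  case: (u x * v x) S {IH} => [a b] [c d]; rewrite /csq /=; ring.
have h : 2 * complex.Re (u x * v x * S^*) <= csq (u x) * B + A * csq (v x).
  apply: (@le_trans _ _ (2 * md (u x * v x * S^*))).
    by rewrite ler_pM2l// Re_md.
  rewrite -(@ler_pXn2r _ 2)//; last 2 first.
  - by rewrite nnegrE mulr_ge0// md_ge0.
  - by rewrite nnegrE addr_ge0// mulr_ge0.
  rewrite exprMn md_sqr !csqM csqJ.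
  have ab0 : 0 <= csq (u x) * csq (v x) by rewrite mulr_ge0.
  apply: (@le_trans _ _ (2 ^+ 2 * (csq (u x) * csq (v x) * (A * B)))).
    by rewrite ler_pM2l ?exprn_gt0// ler_wpM2l.
  have := sqr_ge0 (csq (u x) * B - A * csq (v x)); lra.
rewrite e csqM; lra.
Qed.

End FiniteNorms.

Section IsSum.
Variables (R : realType) (X : choiceType).
Local Notation C := (R[i]).
Implicit Types (F G : {fset X}) (f g : X -> C).

(** Unconditional summation: convergence along the directed set of finite subsets. *)
Definition is_sum f (s : C) := forall e : R, 0 < e ->
  exists F0, forall F, F0 `<=` F -> md (\sum_(x <- F) f x - s) <= e.

Lemma is_sum_unique f s t : is_sum f s -> is_sum f t -> s = t.
Proof.
move=> hs ht; apply/eqP; rewrite -subr_eq0; apply/eqP/md_eq0/eqP.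
rewrite eq_le md_ge0 andbT; apply/ler_addgt0Pr => e e0; rewrite add0r.
have [F1 h1] := hs _ (divr_gt0 e0 (ltr0Sn _ 1)).
have [F2 h2] := ht _ (divr_gt0 e0 (ltr0Sn _ 1)).
have := h1 (F1 `|` F2) (fsubsetUl _ _); have := h2 (F1 `|` F2) (fsubsetUr _ _).
set S := \sum_(x <- _) _ => {}h2 {}h1.
have -> : s - t = (S - t) - (S - s) by ring.
by apply: le_trans (mdB _ _) _; rewrite (splitr e) lerD.
Qed.

Lemma is_sum_eq f g s : (forall x, f x = g x) -> is_sum f s -> is_sum g s.
Proof. by move=> /funext ->. Qed.

Lemma is_sum0 : is_sum (fun=> 0) 0.
Proof. by move=> e e0; exists fset0 => F _; rewrite big1// subr0 md0 ltW. Qed.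

Lemma is_sumD f g s t : is_sum f s -> is_sum g t ->
  is_sum (fun x => f x + g x) (s + t).
Proof.
move=> hs ht e e0.
have [F1 h1] := hs _ (divr_gt0 e0 (ltr0Sn _ 1)).
have [F2 h2] := ht _ (divr_gt0 e0 (ltr0Sn _ 1)).
exists (F1 `|` F2) => F; rewrite fsubUset => /andP[/h1 {}h1 /h2 {}h2].
rewrite big_split /= opprD addrACA; apply: le_trans (mdD _ _) _.
by rewrite (splitr e) lerD.
Qed.

Lemma is_sumZ c f s : is_sum f s -> is_sum (fun x => c * f x) (c * s).
Proof.
move=> hs e e0; have d0 : 0 < md c + 1 by rewrite ltr_wpDl// md_ge0.
have [F0 h] := hs _ (divr_gt0 e0 d0).
exists F0 => F /h {}h; rewrite -mulr_sumr -mulrBr mdM.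
apply: (@le_trans _ _ ((md c + 1) * (e / (md c + 1)))).
  by rewrite ler_pM// ?md_ge0// lerDl.
by rewrite mulrC divfK// gt_eqF.
Qed.

Lemma is_sum_big (I : Type) (r : seq I) (f : I -> X -> C) (s : I -> C) :
  (forall i, is_sum (f i) (s i)) ->
  is_sum (fun x => \sum_(i <- r) f i x) (\sum_(i <- r) s i).
Proof.
move=> h; elim: r => [|i r IH].
  by rewrite big_nil; apply: is_sum_eq is_sum0 => x; rewrite big_nil.
rewrite big_cons; apply: is_sum_eq (is_sumD (h i) IH) => x.
by rewrite big_cons.
Qed.

End IsSum.

(** * Matrices with orthonormal columns *)

Section RealSums.
Variables (R : realType) (X : choiceType).
Implicit Types (F G S : {fset X}) (f : X -> R).

Lemma sum_fsetI_D (V : nmodType) (h : X -> V) F G :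
  \sum_(x <- F) h x = \sum_(x <- F `&` G) h x + \sum_(x <- F `\` G) h x.
Proof.
rewrite (big_fsetID _ (mem G) F) /=; congr (_ + _); apply: perm_big.
  by apply: uniq_perm; rewrite ?fset_uniq// => x; rewrite !inE /=.
by apply: uniq_perm; rewrite ?fset_uniq// => x; rewrite !inE /= andbC.
Qed.

Lemma sum_fsub f F G : (forall x, 0 <= f x) -> F `<=` G ->
  \sum_(x <- F) f x <= \sum_(x <- G) f x.
Proof.
move=> f0 /fsetIidPr FG; rewrite [leRHS](sum_fsetI_D _ _ F) FG lerDl.
exact: sumr_ge0.
Qed.

Lemma sum_rc (I : Type) (s : seq I) (f : I -> R) :
  \sum_(i <- s) rc (f i) = rc (\sum_(i <- s) f i) :> R[i].
Proof. by rewrite rmorph_sum. Qed.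

Lemma is_sum_ub f (s : R) F : (forall x, 0 <= f x) ->
  is_sum (fun x => rc (f x) : R[i]) (rc s) -> \sum_(x <- F) f x <= s.
Proof.
move=> f0 h; apply/ler_addgt0Pr => e /h[G] /(_ (G `|` F) (fsubsetUl _ _)).
rewrite sum_rc -rmorphB md_rc => /(le_trans (ler_norm _)).
rewrite lerBlDl; apply: le_trans.
exact/sum_fsub/fsubsetUr.
Qed.

Lemma is_sum_lb f (s e : R) : 0 < e ->
  is_sum (fun x => rc (f x) : R[i]) (rc s) ->
  exists F, forall G, F `<=` G -> s - e <= \sum_(x <- G) f x.
Proof.
move=> e0 /(_ _ e0)[F h]; exists F => G /h.
by rewrite sum_rc -rmorphB md_rc distrC => /(le_trans (ler_norm _)); lra.
Qed.

Lemma is_sum_tail f (s e : R) : (forall x, 0 <= f x) -> 0 < e ->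
  is_sum (fun x => rc (f x) : R[i]) (rc s) ->
  exists F, forall S, [disjoint S & F] -> \sum_(x <- S) f x <= e.
Proof.
move=> f0 e0 h; have [F hF] := is_sum_lb e0 h; exists F => S dis.
have := hF F (fsubset_refl _); have := is_sum_ub (F `|` S) f0 h.
rewrite (sum_fsetI_D _ _ F) fsetIC fsetKU fsetDUl fsetDv fset0U.
by move/fsetDidPl : dis => ->; lra.
Qed.

End RealSums.

Section Matrices.
Variables (R : realType) (X Y : choiceType).
Local Notation C := (R[i]).
Implicit Types U : Y -> X -> C.

Definition app U (s : seq X) (v : X -> C) : Y -> C :=
  fun y => \sum_(x <- s) U y x * v x.

(** This is U^* U = 1; for [adj U] it becomes U U^* = 1, so unitarity is [orthocols] of both. *)
Definition orthocols U := forall x x',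
  is_sum (fun y => (U y x)^* * U y x') (x == x')%:R.

(** Expanding the square and summing over y leaves the Gram matrix of the columns: U is isometric on
    finitely supported vectors. [bessel] and [parseval_lb] are the two halves of this. *)
Lemma app_is_sum U (S : {fset X}) v : orthocols U ->
  is_sum (fun y => rc (csq (app U S v y)) : C) (rc (n2 S v)).
Proof.
move=> oU; pose c x x' := (v x)^* * v x'.
have h := is_sum_big S (fun x => is_sum_big S (fun x' => is_sumZ (c x x') (oU x x'))).
have -> : rc (n2 S v) = \sum_(x <- S) \sum_(x' <- S) c x x' * (x == x')%:R.
  rewrite -sum_rc; apply: eq_big_seq => x xS.
  rewrite (big_fsetD1 x)//= eqxx mulr1 {1}/c mulJc big1_fset ?addr0// => x'.
  by rewrite !inE eq_sym => /andP[/negPf -> _] _; rewrite mulr0.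
apply: is_sum_eq h => y; rewrite -mulJc conj_sum mulr_suml.
apply: eq_bigr => x _; rewrite mulr_sumr; apply: eq_bigr => x' _.
by rewrite rmorphM /c /=; ring.
Qed.

Lemma bessel U (S : {fset X}) (G : {fset Y}) v : orthocols U ->
  n2 G (app U S v) <= n2 S v.
Proof. by move=> /app_is_sum h; apply: is_sum_ub (h S v) => y; exact: csq_ge0. Qed.

Lemma parseval_lb U (S : {fset X}) v e : orthocols U -> 0 < e ->
  exists G : {fset Y}, forall G' : {fset Y}, G `<=` G' -> n2 S v - e <= n2 G' (app U S v).
Proof. by move=> /app_is_sum h e0; exact: is_sum_lb e0 (h S v). Qed.

Lemma app1 U x (v : X -> C) y : app U [fset x]%fset v y = U y x * v x.
Proof. by rewrite /app big_seq_fset1. Qed.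

Lemma n2_1 (x : X) (v : X -> C) : n2 [fset x]%fset v = csq (v x).
Proof. by rewrite /n2 big_seq_fset1. Qed.

End Matrices.

(** * Equi-quasi-locality *)

Section EquiQuasiLocal.
Variables (R : realType) (X Y : choiceType) (d : X -> X -> R).
Local Notation C := (R[i]).
Implicit Types (U : Y -> X -> C) (A B : {fset X}).

Definition far (r : R) A B := forall x x', x \in A -> x' \in B -> r <= d x x'.

Lemma far_le r s A B : s <= r -> far r A B -> far s A B.
Proof. by move=> sr h x x' xA xB; apply: le_trans sr (h _ _ xA xB). Qed.

Definition ql_matrix (M : X -> X -> C) := forall e : R, 0 < e ->
  exists2 r, 0 < r & forall A B, far r A B -> forall w v : X -> C,
    md (\sum_(x <- A) \sum_(x' <- B) (w x)^* * v x' * M x x') <= e * nm A w * nm B v.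

(** [M] is the matrix of U^* chi_P U; its radii may depend on [P], unlike those in [equi_ql]. *)
Definition ql_cutoffs U := forall P : set Y, exists2 M, ql_matrix M &
  forall x x', is_sum (fun y => if `[< P y >] then (U y x)^* * U y x' else 0) (M x x').

Definition equi_ql U := forall e : R, 0 < e ->
  exists2 r, 0 < r & forall A B, far r A B -> forall (w v : X -> C) (G : {fset Y}),
    md (\sum_(y <- G) (app U A w y)^* * app U B v y) <= e * nm A w * nm B v.

Let tm U A B (w v : X -> C) y := (app U A w y)^* * app U B v y.

Lemma tm_is_sum U (P : set Y) M A B w v :
  (forall x x', is_sum (fun y => if `[< P y >] then (U y x)^* * U y x' else 0) (M x x')) ->
  is_sum (fun y => if `[< P y >] then tm U A B w v y else 0)
    (\sum_(x <- A) \sum_(x' <- B) (w x)^* * v x' * M x x').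
Proof.
move=> h.
have := is_sum_big A (fun x => is_sum_big B (fun x' => is_sumZ ((w x)^* * v x') (h x x'))).
apply: is_sum_eq => y; rewrite /tm conj_sum mulr_suml; case: ifP => _; last first.
  by rewrite big1// => x _; rewrite big1// => x' _; rewrite mulr0.
apply: eq_bigr => x _; rewrite mulr_sumr; apply: eq_bigr => x' _.
by rewrite rmorphM /=; ring.
Qed.

Lemma is_sum_single (f : Y -> C) y :
  is_sum (fun z => if `[< [set y]%classic z >] then f z else 0) (f y).
Proof.
move=> e e0; exists [fset y]%fset => F; rewrite fsub1set => yF.
rewrite (big_fsetD1 y)//= asboolT// big1_fset ?addr0 ?subrr ?md0 ?ltW// => z.
by rewrite !inE => /andP[/eqP zy _] _; rewrite asboolF.
Qed.

(** A finite cut-off is a sum of singleton cut-offs, each quasi-local by itself. The radius depends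
    on [G]; the bound is on absolute values, so it passes to subsets of [G]. *)
Lemma tm_small U (G : {fset Y}) (e : R) : ql_cutoffs U -> 0 < e ->
  exists2 r, 0 < r & forall A B, far r A B -> forall w v,
    \sum_(y <- G) md (tm U A B w v y) <= e * (nm A w * nm B v).
Proof.
move=> qU; elim: (enum_fset G) e => [|y s IH] e e0.
  exists 1 => // A B _ w v; rewrite big_nil; apply: mulr_ge0; first exact: ltW.
  by rewrite mulr_ge0 ?nm_ge0.
have e2 : 0 < e / 2 by rewrite divr_gt0.
have [r r0 hr] := IH _ e2; have [M qM hM] := qU [set y]%classic.
have [r' r'0 hr'] := qM _ e2.
exists (Num.max r r'); first by rewrite lt_max r0.
move=> A B AB w v; rewrite big_cons (splitr e) mulrDl lerD//; last first.
  by apply: hr; apply: far_le AB; rewrite le_max lexx.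
have <- := is_sum_unique (tm_is_sum A B w v hM) (is_sum_single _ y).
by rewrite mulrA; apply: hr'; apply: far_le AB; rewrite le_max lexx orbT.
Qed.

(** A product is at most the sum of the two squares, and both are summable by isometry. *)
Lemma tm_tail U A B w v (e : R) : orthocols U -> 0 < e ->
  exists F : {fset Y}, forall S : {fset Y}, [disjoint S & F] ->
    \sum_(y <- S) md (tm U A B w v y) <= e.
Proof.
move=> oU e0; have e2 : 0 < e / 2 by rewrite divr_gt0.
have [F1 h1] := is_sum_tail (fun y => csq_ge0 _) e2 (app_is_sum A w oU).
have [F2 h2] := is_sum_tail (fun y => csq_ge0 _) e2 (app_is_sum B v oU).
exists (F1 `|` F2) => S.
rewrite fdisjointXU => /andP[/h1 {}h1 /h2 {}h2].
apply: (@le_trans _ _ (\sum_(y <- S) (csq (app U A w y) + csq (app U B v y)))).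
  apply: ler_sum => y _; rewrite /tm mdM mdJ -!md_sqr.
  set a := md _; set b := md _.
  have := sqr_ge0 (a - b); have := sqr_ge0 a; have := sqr_ge0 b; lra.
by rewrite big_split /=; lra.
Qed.

(* Gliding hump: if the cut-offs by finite sets are not equi-quasi-local, the union of a
   sparse sequence of bad finite sets gives a single cut-off which is not quasi-local. *)
Theorem equi_quasi_local U : orthocols U -> ql_cutoffs U -> equi_ql U.
Proof.
move=> oU qU; apply: contrapT => /existsNP[e] /not_implyP[e0 bad].
have {}bad r : 0 < r -> exists A B w v (G : {fset Y}), [/\ far r A B,
    0 < nm A w * nm B v & e * (nm A w * nm B v) < md (\sum_(y <- G) tm U A B w v y)].
  move=> r0; apply: contrapT => nex; apply: bad; exists r => // A B AB w v G.
  rewrite leNgt -mulrA; apply/negP => lt; apply: nex; exists A, B, w, v, G.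
  split => //; rewrite lt_neqAle mulr_ge0 ?nm_ge0// andbT.
  apply/negP => /eqP m0; move: lt; rewrite -m0 mulr0 ltNge => /negP; apply.
  apply: le_trans (md_sum _ _ _) _; rewrite big1// => y _.
  have /eqP := esym m0; rewrite mulf_eq0 => /orP[|] /eqP n0; rewrite /tm mdM mdJ.
    suff -> : app U A w y = 0 by rewrite md0 mul0r.
    apply: md_eq0; apply: le_anti; rewrite md_ge0 andbT.
    apply: le_trans (cauchy_schwarz _ _ _) _; by rewrite n0 mulr0.
  suff -> : app U B v y = 0 by rewrite md0 mulr0.
  apply: md_eq0; apply: le_anti; rewrite md_ge0 andbT.
  apply: le_trans (cauchy_schwarz _ _ _) _; by rewrite n0 mulr0.
(* Four errors of [e / 8] at the end add up to the [e / 2] that the hump exceeds. *)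
have e8 : 0 < e / 8 by rewrite divr_gt0.
(* [G0] is the past and [n] the scale. The new hump [H] avoids [G0], where the new vectors hardly
   contribute, and [G1] is so large that they hardly contribute outside it. *)
have step (p : nat * {fset Y}) : exists t : {fset Y} * {fset Y},
    let: (n, G0) := p in let: (H, G1) := t in
    exists A B w v, [/\ far n%:R A B, 0 < nm A w * nm B v &
    [/\ e / 2 * (nm A w * nm B v) < md (\sum_(y <- H) tm U A B w v y),
       \sum_(y <- G0) md (tm U A B w v y) <= e / 8 * (nm A w * nm B v),
       forall S : {fset Y}, [disjoint S & G1] ->
         \sum_(y <- S) md (tm U A B w v y) <= e / 8 * (nm A w * nm B v) &
       [/\ [disjoint H & G0], H `<=` G1 & G0 `<=` G1]]].
  case: p => n G0; have [r r0 hr] := tm_small G0 qU e8.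
  have m0 : 0 < Num.max r n.+1%:R by rewrite lt_max r0.
  have [A [B [w [v [G [AB mu0 hG]]]]]] := bad _ m0.
  have hG0 := hr _ _ (far_le _ AB) w v; rewrite le_max lexx /= in hG0.
  have {}hG0 := hG0 isT.
  have [F hF] := tm_tail A B w v oU (mulr_gt0 e8 mu0).
  exists (G `\` G0, G `|` G0 `|` F), A, B, w, v; split => //.
    by apply: far_le AB; rewrite le_max ler_nat leqnSn orbT.
  split => //.
  - set mu := nm A w * nm B v in mu0 hG hG0 hF *.
    move: hG; rewrite (sum_fsetI_D _ _ G0) => hG.
    have h1 := lt_le_trans hG (mdD _ _).
    have h2 : md (\sum_(y <- G `&` G0) tm U A B w v y) <= e / 8 * mu.
      apply: le_trans hG0; apply: le_trans (md_sum _ _ _) _.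
      by apply: sum_fsub; [move=> y; exact: md_ge0 | exact: fsubsetIr].
    have : 0 < e * mu by rewrite mulr_gt0.
    by lra.
  - by move=> S; rewrite fdisjointXU => /andP[_ /hF].
  - split.
    + by apply/fdisjointP => y; rewrite inE => /andP[].
    + by apply/fsubsetP => y; rewrite !inE => /andP[_ ->].
    + by apply/fsubsetP => y; rewrite !inE => ->; rewrite orbT.
have [f hf] := choice step.
pose fix st n : {fset Y} := if n is m.+1 then (f (m, st m)).2 else fset0.
pose H n := (f (n, st n)).1.
have stS n : st n.+1 = (f (n, st n)).2 by [].
have key n : exists A B w v, [/\ far n%:R A B, 0 < nm A w * nm B v &
    [/\ e / 2 * (nm A w * nm B v) < md (\sum_(y <- H n) tm U A B w v y),
       \sum_(y <- st n) md (tm U A B w v y) <= e / 8 * (nm A w * nm B v),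
       forall S : {fset Y}, [disjoint S & st n.+1] ->
         \sum_(y <- S) md (tm U A B w v y) <= e / 8 * (nm A w * nm B v) &
       [/\ [disjoint H n & st n], H n `<=` st n.+1 & st n `<=` st n.+1]]].
  by have := hf (n, st n); rewrite stS /H; case: (f _).
have stmono (m n : nat) : (m <= n)%N -> st m `<=` st n.
  move=> /subnK <-; elim: (n - m)%N => [|k IH]; first exact: fsubset_refl.
  apply: fsubset_trans IH _; rewrite addSn.
  by have [A [B [w [v [_ _ [_ _ _ []]]]]]] := key (k + m)%N.
pose P : set Y := [set y | exists n, y \in H n]%classic.
have [M qM hM] := qU P; have [r r0 hr] := qM _ e8.
pose n := (Num.truncn r).+1.
have [A [B [w [v [AB mu0 [h1 h2 h3 [h4 h5 h6]]]]]]] := key n.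
have {}hr := hr _ _ (far_le (ltW (truncnS_gt r)) AB) w v.
rewrite -mulrA in hr; set mu := nm A w * nm B v in mu0 h1 h2 h3 hr.
have [F hF] := tm_is_sum A B w v hM (mulr_gt0 e8 mu0).
set s := \sum_(x <- A) _ in hr hF.
pose S := F `|` st n.+1.
have {}hF := hF S (fsubsetUl _ _).
pose g y := if `[< P y >] then tm U A B w v y else 0.
have gle y : md (g y) <= md (tm U A B w v y).
  by rewrite /g; case: ifP => // _; rewrite md0 md_ge0.
(* Between [st n] and [st n.+1] the set [P] contains only the hump [H n]: earlier humps lie in
   [st n], later ones avoid [st n.+1]. *)
have eS : \sum_(y <- S) g y = \sum_(y <- H n) tm U A B w v y
    + \sum_(y <- st n) g y + \sum_(y <- S `\` st n.+1) g y.
  rewrite (sum_fsetI_D _ S (st n.+1)); congr (_ + _).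
  have -> : S `&` st n.+1 = st n.+1 by apply/fsetIidPr; exact: fsubsetUr.
  rewrite (sum_fsetI_D _ (st n.+1) (st n)) addrC; congr (_ + _); last first.
    by apply: congr_big => //; congr enum_fset; apply/fsetIidPr.
  rewrite (sum_fsetI_D _ (st n.+1 `\` st n) (H n)).
  have -> : (st n.+1 `\` st n) `&` H n = H n.
    apply/fsetIidPr/fsubsetP => y yH; rewrite inE (fsubsetP h5)// andbT.
    exact: (fdisjointP h4).
  rewrite [X in _ + X]big1_fset ?addr0; last first.
    move=> y; rewrite !inE => /andP[yH /andP[y1 y2]] _; rewrite /g asboolF//.
    move=> [m ym]; have [mn|nm|mn] := ltngtP m n.
    - move/negP: y1; apply; apply: (fsubsetP (stmono _ _ mn)).
      have [A' [B' [w' [v' [_ _ [_ _ _ [_ + _]]]]]]] := key m.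
      by move/fsubsetP; exact.
    - have [A' [B' [w' [v' [_ _ [_ _ _ [+ _ _]]]]]]] := key m.
      move/fdisjointP => /(_ _ ym) /negP; apply.
      exact: (fsubsetP (stmono _ _ nm)).
    - by move: yH; rewrite -mn ym.
  by apply: eq_big_seq => y yH; rewrite /g asboolT//; exists n.
have a1 : md (\sum_(y <- st n) g y) <= e / 8 * mu.
  apply: le_trans (md_sum _ _ _) _; apply: le_trans h2.
  exact: ler_sum.
have a2 : md (\sum_(y <- S `\` st n.+1) g y) <= e / 8 * mu.
  apply: le_trans (md_sum _ _ _) _; apply: le_trans (h3 (S `\` st n.+1) _).
    exact: ler_sum.
  by apply/fdisjointP => y; rewrite inE => /andP[].
rewrite -/(g) in hF; move: hF; rewrite -/g eS => hF.
set t0 := \sum_(y <- H n) _ in h1 hF; set t1 := \sum_(y <- st n) _ in a1 hF.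
set t2 := \sum_(y <- _ `\` _) _ in a2 hF.
have : md t0 <= e / 2 * mu.
  have -> : t0 = (t0 + t1 + t2 - s) + s - t1 - t2 by ring.
  apply: le_trans (mdB _ _) _; apply: (@le_trans _ _ (e/8*mu + e/8*mu+ e/8*mu + e/8*mu)).
    apply: lerD => //; apply: le_trans (mdB _ _) _; apply: lerD => //.
    by apply: le_trans (mdD _ _) _; apply: lerD.
  by lra.
by rewrite leNgt h1.
Qed.

End EquiQuasiLocal.

(** * Random signs *)

Local Notation sg b := ((-1) ^+ (nat_of_bool b)).

(* Averaging over independent random signs leaves only the diagonal. *)
Lemma signs_ge_diagonal (R : realType) (Y : eqType) (s : seq Y) (c : Y -> Y -> R) :
  uniq s -> exists sigma : Y -> bool,
  \sum_(y <- s) c y y <=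
  \sum_(y <- s) \sum_(y' <- s) sg (sigma y) * sg (sigma y') * c y y'.
Proof.
elim: s => [_|y s IH /= /andP[ys us]]; first by exists xpredT; rewrite !big_nil.
have [sigma hs] := IH us.
(* Greedy choice in place of an expectation: the sign of [y] makes its cross terms with the signs
   already fixed contribute nonnegatively. *)
pose t := \sum_(y' <- s) sg (sigma y') * (c y y' + c y' y).
pose b := t < 0.
pose sigma' z := if z == y then b else sigma z.
have e z : z \in s -> sigma' z = sigma z.
  by move=> zs; rewrite /sigma'; case: eqP => // zy; rewrite -zy zs in ys.
have ey : sigma' y = b by rewrite /sigma' eqxx.
exists sigma'; rewrite !big_cons ey -signr_addb addbb mul1r.
have -> : \sum_(z <- s) \sum_(y' <- y :: s) sg (sigma' z) * sg (sigma' y') * c z y' =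
    \sum_(z <- s) sg b * (sg (sigma z) * c z y)
    + \sum_(z <- s) \sum_(y' <- s) sg (sigma z) * sg (sigma y') * c z y'.
  rewrite -big_split /=; apply: eq_big_seq => z zs.
  rewrite big_cons ey e//; congr (_ + _); first by ring.
  by apply: eq_big_seq => z' z's; rewrite e.
have -> : \sum_(y' <- s) sg b * sg (sigma' y') * c y y' =
    \sum_(z <- s) sg b * (sg (sigma z) * c y z).
  by apply: eq_big_seq => z zs; rewrite e// mulrA.
have tge : 0 <= sg b * t.
  rewrite /b; case: ltP => t0; first by rewrite expr1 mulN1r oppr_ge0 ltW.
  by rewrite expr0 mul1r.
have et : sg b * t = \sum_(z <- s) sg b * (sg (sigma z) * c y z)
    + \sum_(z <- s) sg b * (sg (sigma z) * c z y).
  rewrite /t mulr_sumr -big_split /=; apply: eq_bigr => z _; ring.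
by move: tge hs; rewrite et; lra.
Qed.

Section Concentration.
Variables (R : realType) (X Y : choiceType) (d : X -> X -> R).
Local Notation C := (R[i]).
Implicit Types (U : Y -> X -> C).

Definition adj U : X -> Y -> C := fun x y => (U y x)^*.

Lemma csq_sg (b : bool) : csq (sg b : C) = 1.
Proof. by case: b; rewrite ?expr1 ?expr0 ?csqN csq1. Qed.

Lemma rc_sg (b : bool) : rc (sg b) = sg b :> C.
Proof. by rewrite rmorphXn rmorphN1. Qed.

Lemma conj_sg (b : bool) : (sg b : C)^* = sg b.
Proof. by rewrite -rc_sg conjc_real. Qed.

Lemma conj_sgM (b : bool) (z : C) : (sg b * z)^* = sg b * z^*.
Proof. by rewrite rmorphM /= conj_sg. Qed.

(** Signs split [G] into two finite cut-offs; each gets half of the tolerance, with a radius valid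
    for every [sigma]. *)
Lemma equi_ql_signs U (e : R) : equi_ql d U -> 0 < e ->
  exists2 r, 0 < r & forall A B, far d r A B -> forall (w v : X -> C) (G : {fset Y}) sigma,
    md (\sum_(y <- G) sg (sigma y) * ((app U A w y)^* * app U B v y)) <= e * nm A w * nm B v.
Proof.
move=> eU e0; have [r r0 hr] := eU _ (divr_gt0 e0 (ltr0Sn _ 1)).
exists r => // A B AB w v G sigma.
rewrite (big_fsetID _ sigma G) /=.
have -> : e * nm A w * nm B v = e / 2 * nm A w * nm B v + e / 2 * nm A w * nm B v by lra.
apply: le_trans (mdD _ _) _; apply: lerD.
  rewrite (eq_big_seq (fun y => -1 * ((app U A w y)^* * app U B v y))); last first.
    by move=> y; rewrite !inE /= => /andP[_ ->].
  by rewrite -mulr_sumr mulN1r mdN; exact: hr.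
rewrite (eq_big_seq (fun y => ((app U A w y)^* * app U B v y))); last first.
  by move=> y; rewrite !inE /= => /andP[_ /negPf ->]; rewrite expr0 mul1r.
exact: hr.
Qed.

Definition bounded_geometry := forall r : R, 0 < r -> exists N : nat,
  forall (x : X) (s : seq X), uniq s -> (forall y, y \in s -> d x y <= r) -> (size s <= N)%N.

Lemma fset_of_bounded (T : choiceType) (P : T -> Prop) (N : nat) :
  (forall s, uniq s -> (forall y, y \in s -> P y) -> (size s <= N)%N) ->
  exists B : {fset T}, forall z, z \in B <-> P z.
Proof.
move=> h; pose Q n := `[< exists s : seq T, [/\ uniq s, forall y, y \in s -> P y & size s = n] >].
have exQ : exists n, Q n by exists 0%N; apply/asboolP; exists [::].
have ubQ n : Q n -> (n <= N)%N by move=> /asboolP[s [us sP <-]]; exact: h.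
case: (ex_maxnP exQ ubQ) => n /asboolP[s [us sP sn]] nmax.
exists [fset x in s]%fset => z; rewrite !inE /=; split => [/sP//|Pz].
apply: contrapT => /negP zs; have := nmax n.+1; rewrite ltnn => /(_ _)/wrap[]//.
apply/asboolP; exists (z :: s); split => /=; rewrite ?zs ?sn//.
by move=> y; rewrite inE => /orP[/eqP ->|/sP].
Qed.

Lemma balls_fset : bounded_geometry -> forall r : R, 0 < r ->
  exists N : nat, forall x, exists B : {fset X},
    (forall z, z \in B <-> d x z <= r) /\ (#|` B| <= N)%N.
Proof.
move=> bg r /bg[N hN]; exists N => // x.
have [B hB] := fset_of_bounded (hN x); exists B; split => //.
by apply: (hN x) => [|y /hB//]; exact: fset_uniq.
Qed.

Lemma app_cst1 U x y : app U [fset x]%fset (fun=> 1) y = U y x.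
Proof. by rewrite app1 mulr1. Qed.

Lemma col_bessel U (G : {fset Y}) x : orthocols U -> \sum_(y <- G) csq (U y x) <= 1.
Proof.
move=> oU; have := bessel [fset x]%fset G (fun=> 1) oU.
by rewrite n2_1 csq1 /n2; under eq_bigr do rewrite app_cst1.
Qed.

(* With random signs on Y, the vector U^* (sigma . U delta_x) has, on average, entries of
   squared modulus at most max_y |U y x|^2; equi-quasi-locality keeps most of its mass in a
   ball around x, which has boundedly many points, so that maximum is bounded below. *)
Lemma columns_bounded_below U : (forall x y, d x y = d y x) -> bounded_geometry ->
  orthocols U -> orthocols (adj U) -> equi_ql d U ->
  exists2 delta : R, 0 < delta & forall x, exists y, delta <= csq (U y x).
Proof.
move=> dC bg oU oU' eU.
have e2 : 0 < 1 / 2 :> R by rewrite divr_gt0.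
have [r r0 hr] := equi_ql_signs eU e2.
have [N hN] := balls_fset bg r0.
have N1 : 0 < 4 * N.+1%:R :> R by rewrite mulr_gt0// ltr0n.
(* With this [delta] the at most [N] points of the ball carry mass at most 1/4; the successor avoids
   dividing by 0. *)
exists (4 * N.+1%:R)^-1; first by rewrite invr_gt0.
set delta := _^-1 => x; apply: contrapT => /forallNP small.
have {}small y : csq (U y x) <= delta by rewrite leNgt; apply/negP => /ltW; exact: small.
have [F hF] : exists F : {fset Y}, 7 / 8 <= n2 F (fun y => U y x).
  have [F] := parseval_lb [fset x]%fset (fun=> 1) oU (divr_gt0 ltr01 (ltr0Sn R 7)).
  move=> /(_ F (fsubset_refl _)); rewrite n2_1 csq1 => hF; exists F.
  by move: hF; rewrite /n2; under eq_bigr do rewrite app_cst1; lra.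
have [B [hB cB]] := hN x.
pose k z y := (U y z)^* * U y x.
(* The sign lemma bounds from below; the negated entries turn it into an upper bound for the mass of
   [p] on [B]. *)
have [sigma hs] := signs_ge_diagonal
  (fun y y' => - \sum_(z <- B) complex.Re ((k z y)^* * k z y')) (fset_uniq F).
pose v y := sg (sigma y) * U y x.
pose p := app (adj U) F v.
have pE z : p z = \sum_(y <- F) sg (sigma y) * k z y.
  by apply: eq_bigr => y _; rewrite /adj /v /k; ring.
have pB : n2 B p <= 1 / 4.
  apply: (@le_trans _ _ (\sum_(y <- F) \sum_(z <- B) csq (k z y))).
    suff -> : n2 B p = \sum_(y <- F) \sum_(y' <- F)
        sg (sigma y) * sg (sigma y') * \sum_(z <- B) complex.Re ((k z y)^* * k z y').
      move: hs; under eq_bigr do under eq_bigr do rewrite mulJc /=.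
      rewrite sumrN lerNl -sumrN; under eq_bigr do rewrite -sumrN.
      by under eq_bigr do under eq_bigr do rewrite mulrN opprK.
    have -> : n2 B p = \sum_(z <- B) \sum_(y <- F) \sum_(y' <- F)
        sg (sigma y) * sg (sigma y') * complex.Re ((k z y)^* * k z y').
      apply: eq_bigr => z _; rewrite -[csq _]/(complex.Re (rc (csq (p z)))) -mulJc pE.
      rewrite conj_sum mulr_suml Re_sum; apply: eq_bigr => y _.
      rewrite mulr_sumr Re_sum; apply: eq_bigr => y' _.
      rewrite conj_sgM -!rc_sg.
      set a := sg (sigma y); set b := sg _; case: (k z y) (k z y') => [? ?] [? ?].
      by rewrite /=; ring.
    rewrite exchange_big /=; apply: eq_bigr => y _.
    rewrite exchange_big /=; apply: eq_bigr => y' _.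
    by rewrite mulr_sumr.
  rewrite exchange_big /=.
  apply: (@le_trans _ _ (\sum_(z <- B) delta)).
    apply: ler_sum => z _.
    apply: (@le_trans _ _ (\sum_(y <- F) delta * csq (U y z))).
      apply: ler_sum => y _; rewrite /k csqM csqJ mulrC ler_wpM2r// csq_ge0//.
    rewrite -mulr_sumr ler_piMr//; [by rewrite /delta invr_ge0 ltW | exact: col_bessel].
  rewrite big_const_seq count_predT iter_addr_0.
  rewrite -[leLHS]mulr_natl /delta ler_pdivrMr//.
  have : (#|` B|)%:R <= N%:R :> R by rewrite ler_nat.
  rewrite -(natr1 N); lra.
have [S0 hS0] := parseval_lb F v oU' (divr_gt0 ltr01 (ltr0Sn R 7)).
have {}hS0 := hS0 (S0 `|` B) (fsubsetUl _ _); rewrite -/p in hS0.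
have nv : n2 F v = n2 F (fun y => U y x).
  by apply: eq_bigr => y _; rewrite /v csqM csq_sg mul1r.
set S := S0 `|` B in hS0; pose A := S `\` B.
(* Of the mass 7/8 kept on [F], at most 1/8 is lost by truncation to [S] and at most 1/4 lies in the
   ball. *)
have pA : 1 / 2 <= n2 A p.
  have : n2 S p <= n2 B p + n2 A p.
    rewrite /n2 (sum_fsetI_D _ S B) lerD2r; apply: sum_fsub; last exact: fsubsetIr.
    by move=> z; exact: csq_ge0.
  by move: hS0; rewrite nv; lra.
have AB : far d r A [fset x]%fset.
  move=> z x'; rewrite !inE => /andP[/negP zB _] /eqP ->; rewrite dC leNgt.
  by apply/negP => /ltW /hB.
(* Pairing [p] with itself on [A] gives [q ^+ 2 <= q / 2], so its mass there is at most 1/4. *)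
have := hr _ _ AB p (fun=> 1) F sigma.
have -> : \sum_(y <- F) sg (sigma y) * ((app U A p y)^* * app U [fset x]%fset (fun=> 1) y)
    = rc (n2 A p).
  rewrite -sum_rc.
  transitivity (\sum_(y <- F) \sum_(z <- A) (p z)^* * (sg (sigma y) * k z y)).
    apply: eq_bigr => y _; rewrite app_cst1 conj_sum mulr_suml mulr_sumr.
    by apply: eq_bigr => z _; rewrite rmorphM /k /=; ring.
  rewrite exchange_big /=; apply: eq_bigr => z _.
  by rewrite -mulr_sumr -pE mulJc.
rewrite md_rc ger0_norm ?n2_ge0// /nm n2_1 csq1 sqrtr1 mulr1 -/(nm A p).
have := nm_sqr A p; have := nm_ge0 A p; set q := nm A p => q0 qE.
rewrite -qE in pA * => h; nra.
Qed.

(** Let t be [app U A v]. The vector w built from the terms [sg (sigma y) * t y / U y (g y)] placed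
    at [g y] is supported on g(D), far from [A]. In its pairing with v through U^* sigma U the
    diagonal terms are [csq (t y)], so well-chosen signs bound [n2 D t] by the quasi-locality
    estimate. It remains to bound the norm of w by that of t. *)
Lemma decay U (g : Y -> X) (delta : R) : 0 < delta ->
  (forall y, delta <= csq (U y (g y))) -> orthocols U -> equi_ql d U ->
  forall e : R, 0 < e -> exists2 r, 0 < r & forall (A : {fset X}) (D : {fset Y}),
    (forall y x, y \in D -> x \in A -> r <= d (g y) x) ->
    forall v : X -> C, n2 D (app U A v) <= e * n2 A v.
Proof.
move=> delta0 gU oU eU e e0; pose e' := delta * Num.sqrt e.
have se : 0 < Num.sqrt e by rewrite sqrtr_gt0.
have e'0 : 0 < e' by rewrite mulr_gt0.
have [r r0 hr] := equi_ql_signs eU e'0.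
exists r => // A D hAD v; pose t := app U A v.
pose tau y := t y / U y (g y).
have U0 y : U y (g y) != 0.
  by apply/negP => /eqP u0; have := gU y; rewrite u0 csq0 leNgt delta0.
have [sigma hs] := signs_ge_diagonal
  (fun y y' => complex.Re ((U y (g y') * tau y')^* * t y)) (fset_uniq D).
pose W := [fset g y | y in D]%fset.
pose w x := \sum_(y <- D) if g y == x then sg (sigma y) * tau y else 0.
have WA : far d r W A.
  by move=> x x' /imfsetP[y /= yD ->] x'A; exact: hAD.
have appW y : app U W w y = \sum_(y' <- D) sg (sigma y') * (U y (g y') * tau y').
  rewrite /app; under eq_bigr do rewrite mulr_sumr.
  rewrite exchange_big /=; apply: eq_big_seq => y' y'D.
  rewrite (big_fsetD1 (g y')) /=; last by apply/imfsetP; exists y'.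
  rewrite eqxx big1_fset ?addr0; first by ring.
  by move=> x; rewrite !inE eq_sym => /andP[/negPf -> _] _; rewrite mulr0.
have nw : n2 W w <= delta ^- 2 * n2 D t.
  apply: (@le_trans _ _ (\sum_(x <- W) \sum_(y <- D)
      if g y == x then delta ^- 2 * csq (t y) else 0)).
    apply: ler_sum => x _.
    (* Writing 1/u as conj(u)/|u|^2 makes the sum over a fibre of [g] a pairing with column [x],
       whose norm is at most 1; the size of the fibre does not enter. *)
    pose b y := if g y == x then sg (sigma y) * t y / rc (csq (U y (g y))) else 0.
    have -> : w x = \sum_(y <- D) (U y x)^* * b y.
      apply: eq_bigr => y _; rewrite /b; case: eqP => [<-|]; last by rewrite mulr0.
      rewrite -mulJc /tau; field; rewrite U0 /=.
      by rewrite conjc_eq0 U0.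
    have cs := cauchy_schwarz D (fun y => (U y x)^*) b.
    rewrite -(@ler_pXn2r _ 2) ?nnegrE ?md_ge0 ?mulr_ge0 ?nm_ge0// in cs.
    rewrite exprMn !nm_sqr md_sqr in cs; apply: le_trans cs _.
    apply: (@le_trans _ _ (n2 D b)).
      rewrite ler_piMl ?n2_ge0// /n2; under eq_bigr do rewrite csqJ; exact: col_bessel.
    apply: ler_sum => y _; rewrite /b; case: ifP => _; last by rewrite csq0.
    rewrite csqM csqM csq_sg mul1r mulrC ler_wpM2r ?csq_ge0//.
    rewrite -rmorphV /=; last by rewrite unitfE gt_eqF// (lt_le_trans delta0).
    rewrite csq_real exprVn lef_pV2 ?posrE ?exprn_gt0//; last exact: lt_le_trans (gU _).
    by rewrite ler_pXn2r// nnegrE ?csq_ge0// ltW.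
  rewrite exchange_big /= /n2 mulr_sumr big_seq [leRHS]big_seq; apply: ler_sum => y yD.
  rewrite (big_fsetD1 (g y)) /=; last by apply/imfsetP; exists y.
  rewrite eqxx big1_fset ?addr0// => x.
  by rewrite !inE eq_sym => /andP[/negPf -> _] _.
have T0 := n2_ge0 D t; have V0 := nm_ge0 A v; have q0 := nm_ge0 D t.
have main : n2 D t <= e' * nm W w * nm A v.
  apply: le_trans (hr _ _ WA w v D sigma); apply: le_trans (Re_md _).
  move: hs; rewrite -/t.
  have -> : \sum_(y <- D) complex.Re ((U y (g y) * tau y)^* * t y) = n2 D t.
    apply: eq_bigr => y _; rewrite /tau [U y (g y) * _]mulrC divfK//.
    by rewrite mulJc.
  move=> /le_trans; apply; rewrite Re_sum le_eqVlt; apply/orP; left; apply/eqP.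
  apply: eq_bigr => y _; rewrite appW conj_sum mulr_suml mulr_sumr Re_sum.
  apply: eq_bigr => y' _; rewrite conj_sgM -!rc_sg.
  set a := sg (sigma y); set b := sg _; case: (_^*) (t y) => [? ?] [? ?].
  by rewrite /=; ring.
have nw' : nm W w <= delta^-1 * nm D t.
  rewrite -(@ler_pXn2r _ 2) ?nnegrE ?nm_ge0//; last by rewrite mulr_ge0// invr_ge0 ltW.
  by rewrite exprMn !nm_sqr exprVn.
have h : n2 D t <= Num.sqrt e * nm D t * nm A v.
  apply: le_trans main _; apply: ler_wpM2r => //.
  rewrite -[leRHS](_ : delta * Num.sqrt e * (delta^-1 * nm D t) = _).
    by rewrite ler_wpM2l// ltW.
  by field; rewrite gt_eqF.
have hq : nm D t <= Num.sqrt e * nm A v.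
  have [->|qn0] := eqVneq (nm D t) 0; first by rewrite mulr_ge0// ltW.
  have qp : 0 < nm D t by rewrite lt_neqAle eq_sym qn0.
  by rewrite -(ler_pM2r qp) -expr2 nm_sqr mulrAC; exact: h.
have : nm D t ^+ 2 <= (Num.sqrt e * nm A v) ^+ 2.
  by rewrite ler_pXn2r ?nnegrE// mulr_ge0// ltW.
by rewrite exprMn !nm_sqr sqr_sqrtr// ltW.
Qed.

End Concentration.

(** * Matchings *)

Section Hall.
Variables X Y : choiceType.
Implicit Types (L : X -> {fset Y}) (A B : {fset X}).

Definition neighbours L A : {fset Y} := (\bigcup_(x <- A) L x)%fset.

Definition hall L := forall A, (#|` A| <= #|` neighbours L A|)%N.

Lemma neighboursP L A y :
  reflect (exists2 x, x \in A & y \in L x) (y \in neighbours L A).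
Proof.
apply: (iffP (bigfcupP _ _ _ _)) => -[x].
  by rewrite andbT => xA yx; exists x.
by move=> xA yx; exists x; rewrite ?xA.
Qed.

Lemma neighboursS L L' A : (forall x, x \in A -> L x `<=` L' x) ->
  neighbours L A `<=` neighbours L' A.
Proof.
move=> h; apply/fsubsetP => y /neighboursP[x xA yx]; apply/neighboursP.
by exists x => //; apply: (fsubsetP (h x xA)).
Qed.

(** For finite [A], a member of the chain of least total size on [A] lies below all others there, so
    the intersection agrees with it on [A]. Intersecting inside [L0] keeps the sets finite. *)
Lemma hall_chain L0 (T : set (X -> {fset Y})) : T L0 -> (forall L, T L -> hall L) ->
  (forall L L', T L -> T L' ->
     (forall x, L x `<=` L' x) \/ (forall x, L' x `<=` L x)) ->
  exists2 L, hall L & forall L', T L' -> forall x, L x `<=` L' x.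
Proof.
move=> T0 Th tot.
exists (fun x => [fset y in L0 x | `[< forall L, T L -> y \in L x >]]%fset); last first.
  by move=> L' TL' x; apply/fsubsetP => y; rewrite !inE => /andP[_ /asboolP]; exact.
move=> A.
pose Q n := `[< exists2 L, T L & (\sum_(x <- A) #|` L x|)%N = n >].
have exQ : exists n, Q n.
  by exists (\sum_(x <- A) #|` L0 x|)%N; apply/asboolP; exists L0.
case: (ex_minnP exQ) => n /asboolP[L TL Ln] nmin.
apply: leq_trans (Th _ TL A) _; apply: fsubset_leq_card; apply: neighboursS => x xA.
suff h L' : T L' -> L x `<=` L' x.
  apply/fsubsetP => y yL; rewrite !inE /= (fsubsetP (h _ T0))//=.
  by apply/asboolP => L' TL'; apply: (fsubsetP (h _ TL')).
move=> TL'; have [//|L'L] := tot _ _ TL TL'.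
have le z : (#|` L' z| <= #|` L z|)%N by exact: fsubset_leq_card.
have : (\sum_(x <- A) #|` L x| <= \sum_(x <- A) #|` L' x|)%N.
  by rewrite Ln; apply: nmin; apply/asboolP; exists L'.
rewrite (big_fsetD1 x)//= [X in (_ <= X)%N](big_fsetD1 x)//= => hsum.
have le2 : (\sum_(z <- A `\ x) #|` L' z| <= \sum_(z <- A `\ x) #|` L z|)%N.
  by apply: leq_sum.
have /eqP <- // : L' x == L x; rewrite ?fsubset_refl//.
rewrite eqEfcard L'L /=.
by rewrite -(leq_add2r (\sum_(z <- A `\ x) #|` L z|)%N); apply: leq_trans hsum _; rewrite leq_add2l.
Qed.

(* Rado's argument: a minimal family satisfying Hall's condition consists of singletons. *)
Theorem hall_marriage L : hall L ->
  exists2 h : X -> Y, injective h & forall x, h x \in L x.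
Proof.
move=> hL.
pose T := {L' : X -> {fset Y} | hall L' /\ forall x, L' x `<=` L x}.
have L0 : hall L /\ forall x, L x `<=` L x by split.
pose t0 : T := exist _ L L0.
(* Reversed inclusion, so that Zorn's maximal element is a minimal family. *)
pose le (s t : T) := `[< forall x, sval t x `<=` sval s x >].
have [||S|M Mmin] := @ZL_preorder T t0 le.
- by move=> t; apply/asboolP => x.
- move=> r s t /asboolP rs /asboolP st; apply/asboolP => x.
  exact: fsubset_trans (st x) (rs x).
- move=> tot; have [[s Ss]|nS] := pselect (exists s, S s); last first.
    by exists t0 => s Ss; exfalso; apply: nS; exists s.
  pose S' : set (X -> {fset Y}) := [set L' | exists2 s, S s & sval s = L']%classic.
  have [|L'|L1 L2|L' hL' L'le] := @hall_chain (sval s) S'.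
  + by exists s.
  + by move=> [t _ <-]; have [] := svalP t.
  + move=> [s1 S1 <-] [s2 S2 <-].
    by have [/asboolP|/asboolP] := tot _ _ S1 S2; [right|left].
  + have L'L x : L' x `<=` L x.
      apply: fsubset_trans (proj2 (svalP s) x); apply: L'le; by exists s.
    exists (exist _ L' (conj hL' L'L)) => t St; apply/asboolP => x /=.
    by apply: L'le; exists t.
case: M Mmin => M [hM ML] Mmin.
have card1 x : (#|` M x| <= 1)%N.
  rewrite leqNgt; apply/negP => c2.
  have [y1 y1M] : exists y, y \in M x.
    by apply/fset0Pn; rewrite -cardfs_gt0 (ltn_trans _ c2).
  have [y2] : exists y, y \in M x `\ y1.
    apply/fset0Pn; rewrite -cardfs_gt0; move: c2.
    by rewrite (cardfsD1 y1) y1M.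
  rewrite !inE => /andP[y21 y2M].
  (* By minimality, deleting [y] from [M x] breaks Hall's condition at some set containing [x]; [B]
     is that set without [x]. *)
  have del y : y \in M x -> exists2 B, x \notin B &
      (#|` neighbours M B `|` (M x `\ y)| <= #|` B|)%N.
    move=> yM; pose M' z := if z == x then M x `\ y else M z.
    have M'M z : M' z `<=` M z.
      by rewrite /M'; case: eqP => // ->; exact: fsubD1set.
    have nh : ~ hall M'.
      move=> hM'; have M'L z : M' z `<=` L z by apply: fsubset_trans (ML z).
      have le' : le (exist _ M (conj hM ML)) (exist _ M' (conj hM' M'L)) by apply/asboolP.
      have /asboolP := Mmin _ le'.
      by move=> /(_ x)/fsubsetP/(_ y yM); rewrite /= /M' eqxx !inE eqxx.
    have /existsNP[A /negP] := nh; rewrite -ltnNge => lt.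
    have xA : x \in A.
      apply: contraLR lt => xA; rewrite -leqNgt; apply: leq_trans (hM A) _.
      apply/fsubset_leq_card/neighboursS => z zA; rewrite /M'.
      by case: eqP zA => // ->; rewrite (negPf xA).
    exists (A `\ x); first by rewrite !inE eqxx.
    move: lt; rewrite (cardfsD1 x A) xA add1n ltnS; apply: leq_trans.
    apply: fsubset_leq_card; apply/fsubsetP => z; rewrite inE => /orP[|].
      move=> /neighboursP[u]; rewrite !inE => /andP[ux uA] zu; apply/neighboursP.
      by exists u => //; rewrite /M' (negPf ux).
    by move=> zx; apply/neighboursP; exists x => //; rewrite /M' eqxx.
  have [B1 xB1 h1] := del y1 y1M; have [B2 xB2 h2] := del y2 y2M.
  set M1 := _ `|` _ in h1; set M2 := _ `|` _ in h2.
  (* Submodularity: as [y1] and [y2] differ, the union of [M1] and [M2] contains [M x]; adding [hU]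
     and [hI] then contradicts [h1] and [h2] by one element. *)
  have hU : (#|` x |` (B1 `|` B2)| <= #|` M1 `|` M2|)%N.
    apply: leq_trans (hM _) _; apply/fsubset_leq_card/fsubsetP => z /neighboursP[u].
    rewrite !inE => /orP[/eqP ->|/orP[uB|uB]] zu.
    - rewrite zu !andbT; case: (eqVneq z y1) => [->|zy]; last by rewrite orbT.
      by rewrite eq_sym y21 !orbT.
    - by apply/orP; left; apply/orP; left; apply/neighboursP; exists u.
    - by apply/orP; right; apply/orP; left; apply/neighboursP; exists u.
  have hI : (#|` B1 `&` B2| <= #|` M1 `&` M2|)%N.
    apply: leq_trans (hM _) _; apply/fsubset_leq_card/fsubsetP => z /neighboursP[u].
    rewrite !inE => /andP[u1 u2] zu; apply/andP; split; apply/orP; left.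
      by apply/neighboursP; exists u.
    by apply/neighboursP; exists u.
  have := leq_add h1 h2; rewrite -(cardfsUI M1 M2) -(cardfsUI B1 B2) leqNgt => /negP; apply.
  apply: leq_trans (leq_add hU hI); rewrite cardfsU1.
  by rewrite !inE (negPf xB1) (negPf xB2) add1n addSn.
have ex x : exists y, y \in M x.
  apply/fset0Pn; rewrite -cardfs_gt0; have := hM [fset x]%fset.
  rewrite cardfs1; suff -> : neighbours M [fset x]%fset = M x by [].
  apply/fsetP => y; apply/neighboursP/idP => [[z /fset1P -> //]|yx].
  by exists x => //; rewrite inE.
have [h hh] := choice ex; exists h; last by move=> x; apply: (fsubsetP (ML x)).
move=> x x' e; apply: contrapT => /eqP ne.
have eqh z : M z = [fset h z]%fset.
  apply/eqP; rewrite eq_sym eqEfcard cardfs1 card1 andbT.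
  by rewrite fsub1set.
have := hM [fset x; x']%fset; rewrite cardfs2 ne; apply/negP; rewrite -ltnNge ltnS.
suff -> : neighbours M [fset x; x']%fset = [fset h x]%fset by rewrite cardfs1.
apply/fsetP => y; apply/neighboursP/idP => [[z /fset2P[->|->]]|]; rewrite ?eqh ?e//.
by move=> yx; exists x' => //; rewrite ?eqh// !inE eqxx orbT.
Qed.

End Hall.

(** The second conclusion carries the geometry: where [b] is not [h] it inverts [k], so distance
    estimates for [h] and [k] pass to [b]. [S] collects the orbits that start outside the image of
    [k]. *)
Lemma schroeder_bernstein (X Y : Type) (h : X -> Y) (k : Y -> X) :
  injective h -> injective k ->
  exists2 b : X -> Y, bijective b & forall x, b x = h x \/ x = k (b x).
Proof.
move=> hi ki.
pose S x := exists n z, (forall y, k y <> z) /\ x = iter n (k \o h) z.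
have ex x : exists y, (S x -> y = h x) /\ (~ S x -> k y = x).
  have [Sx|nS] := pselect (S x); first by exists (h x).
  suff [y yx] : exists y, k y = x by exists y.
  by apply: contrapT => ny; apply: nS; exists 0%N, x; split => // y yx; apply: ny; exists y.
have [b hb] := choice ex.
have Skh x : S x -> S (k (h x)).
  by move=> [n [z [hz ->]]]; exists n.+1, z.
have bi : injective b.
  move=> x x' e; have [hx nx] := hb x; have [hx' nx'] := hb x'.
  have [Sx|Sx] := pselect (S x); have [Sx'|Sx'] := pselect (S x').
  - by apply: hi; rewrite -hx// -hx'.
  - by have := Skh _ Sx; rewrite -(hx Sx) e (nx' Sx').
  - by have := Skh _ Sx'; rewrite -(hx' Sx') -e (nx Sx).
  - by rewrite -(nx Sx) e (nx' Sx').
have bs y : exists x, b x = y.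
  have [Sy|Sy] := pselect (S (k y)); last first.
    by exists (k y); apply: ki; exact: (proj2 (hb (k y))).
  case: Sy => -[|n] [z [hz e]]; first by exfalso; exact: hz e.
  have Sx : S (iter n (k \o h) z) by exists n, z.
  exists (iter n (k \o h) z); rewrite (proj1 (hb _) Sx).
  by apply: ki; rewrite e.
have [c bc] := choice bs.
exists b; first by exists c => // x; apply: bi.
move=> x; have [Sx|Sx] := pselect (S x); first by left; exact: (proj1 (hb x)).
by right; rewrite (proj2 (hb x)).
Qed.

Lemma wide_matrix_kernel (F : fieldType) (X Y : choiceType) (U : Y -> X -> F)
    (s : seq X) (t : seq Y) : uniq s -> (size t < size s)%N ->
  exists v : X -> F, (exists2 x, x \in s & v x != 0) /\
    forall y, y \in t -> \sum_(x <- s) U y x * v x = 0.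
Proof.
move=> us lt.
(* [kermx] is a left kernel, so the columns of [U] become the rows of [M]. *)
pose M : 'M[F]_(size s, size t) :=
  \matrix_(i, j) U (tnth (in_tuple t) j) (tnth (in_tuple s) i).
have : kermx M != 0.
  rewrite kermx_eq0 /row_free; apply/negP => /eqP rM.
  by have := rank_leq_col M; rewrite rM leqNgt lt.
move=> /matrix0Pn[i0 [i ui]]; pose u := row i0 (kermx M).
have uM : u *m M = 0 by rewrite -row_mul mulmx_ker row0.
pose v x := oapp (fun j => u 0 j) 0 (insub (index x s) : option 'I_(size s)).
have vE j : v (tnth (in_tuple s) j) = u 0 j.
  rewrite /v (tnth_nth (tnth (in_tuple s) j)) /= index_uniq//.
  by rewrite -[nat_of_ord j]/(val j) valK.
exists v; split.
  by exists (tnth (in_tuple s) i); [exact: mem_tnth | rewrite vE mxE].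
move=> y yt; have yi : (index y t < size t)%N by rewrite index_mem.
have := congr1 (fun A : 'rV[F]_(size t) => A 0 (Ordinal yi)) uM; rewrite !mxE => e.
rewrite big_tnth -[RHS]e; apply: eq_bigr => j _.
by rewrite vE !mxE mulrC (tnth_nth y) /= nth_index.
Qed.

(** Otherwise some nonzero vector on [A] is annihilated by the rows in [N]; by isometry at least
    half of its squared norm lies outside [N], against the assumed quarter. *)
Lemma card_le_neighbours (R : realType) (X Y : choiceType) (U : Y -> X -> R[i])
    (A : {fset X}) (N : {fset Y}) : orthocols U ->
  (forall (D : {fset Y}) v, [disjoint D & N] -> n2 D (app U A v) <= 1 / 4 * n2 A v) ->
  (#|` A| <= #|` N|)%N.
Proof.
move=> oU dec; rewrite leqNgt; apply/negP => lt.
have [v [[x xA vx] v0]] := wide_matrix_kernel U (fset_uniq A) lt.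
have nv : 0 < n2 A v.
  rewrite /n2 (big_fsetD1 x)//= ltr_pwDl//; last by apply: sumr_ge0 => z _; exact: csq_ge0.
  by rewrite lt_neqAle csq_ge0 andbT eq_sym; apply: contraNneq vx => /csq_eq0 ->.
have [G hG] := parseval_lb A v oU (divr_gt0 nv (ltr0Sn R 1)).
have {hG} := hG G (fsubset_refl _).
rewrite [n2 G _]/n2 (sum_fsetI_D _ G N) big1_fset; last first.
  by move=> y; rewrite inE => /andP[_ yN] _; rewrite /app v0// csq0.
have disj : [disjoint G `\` N & N] by apply/fdisjointP => y; rewrite inE => /andP[].
rewrite add0r; have := dec _ v disj; rewrite {1}/n2; lra.
Qed.

(** * Controlled bijections *)

Section Injection.
Variables (R : realType) (X Y : choiceType) (d : X -> X -> R).
Local Notation C := (R[i]).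
Implicit Types (U : Y -> X -> C).

Lemma injection_near U (g : Y -> X) (delta : R) : (forall x y, d x y = d y x) ->
  bounded_geometry d -> orthocols U -> equi_ql d U -> 0 < delta ->
  (forall y, delta <= csq (U y (g y))) ->
  exists2 r : R, 0 < r & exists2 h : X -> Y, injective h & forall x, d (g (h x)) x <= r.
Proof.
move=> dC bg oU eU delta0 gU.
have e4 : 0 < 1 / 4 :> R by rewrite divr_gt0.
have [r r0 hr] := decay delta0 gU oU eU e4.
have [N hN] := balls_fset bg r0.
have exL x : exists B : {fset Y}, forall y, y \in B <-> d (g y) x <= r.
  have [B [hB cB]] := hN x.
  (* Each [y] in the list has mass at least [delta] in the columns of the ball [B], whose total mass
     is at most [N]. *)
  apply: (@fset_of_bounded _ _ (Num.truncn (N%:R / delta))) => s us sr.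
  rewrite -ltnS -(ltr_nat R); apply: le_lt_trans (truncnS_gt _).
  rewrite ler_pdivlMr//.
  pose S := [fset y in s]%fset.
  have sE f : \sum_(y <- s) f y = \sum_(y <- S) f y :> R.
    by apply: perm_big; apply: uniq_perm => // y; rewrite !inE.
  apply: (@le_trans _ _ (\sum_(y <- s) csq (U y (g y)))).
    apply: (@le_trans _ _ (\sum_(y <- s) delta)); last exact: ler_sum.
    by rewrite big_const_seq count_predT iter_addr_0 -[leRHS]mulr_natl.
  apply: (@le_trans _ _ (\sum_(y <- s) \sum_(z <- B) csq (U y z))).
    rewrite big_seq [leRHS]big_seq; apply: ler_sum => y ys.
    have gB : g y \in B by apply/hB; rewrite dC; exact: sr.
    by rewrite (big_fsetD1 _ gB) /= lerDl sumr_ge0// => z _; exact: csq_ge0.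
  rewrite exchange_big /=; apply: (@le_trans _ _ (\sum_(z <- B) 1)).
    by apply: ler_sum => z _; rewrite sE; exact: col_bessel.
  by rewrite big_const_seq count_predT iter_addr_0 ler_nat.
have [L hL] := choice exL; exists r => //.
have [A|h hi hh] := @hall_marriage _ _ L; last by exists h => // x; apply/hL.
apply: (card_le_neighbours oU) => D v /fdisjointP disj; apply: hr => y x yD xA.
rewrite leNgt; apply/negP => /ltW /hL yx; have /negP := disj _ yD; apply.
by apply/neighboursP; exists x.
Qed.

Definition l2b (v : X -> C) (M : R) := forall F : {fset X}, n2 F v <= M.

(** The cut-off at the single point [y], tested on the conjugate of row [y] over [F] and on the
    basis vector at [x], bounds [n2 F (U y) * md (U y x)] by [e * nm F (U y)]. One factor
    [nm F (U y)] cancels. *)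
Lemma row_concentration U (delta k : R) : equi_ql d U -> 0 < delta -> 0 < k ->
  exists2 s, 0 < s & forall y x (F : {fset X}), delta <= csq (U y x) ->
    (forall z, z \in F -> s <= d z x) -> n2 F (U y) <= k.
Proof.
move=> eU delta0 k0; pose e := Num.sqrt (k * delta).
have e0 : 0 < e by rewrite sqrtr_gt0 mulr_gt0.
have [s s0 hs] := eU _ e0; exists s => // y x F Uyx Fx.
have AB : far d s F [fset x]%fset by move=> z x' zF /fset1P ->; exact: Fx.
have := hs _ _ AB (fun z => (U y z)^*) (fun=> 1) [fset y]%fset.
rewrite big_seq_fset1 app_cst1.
have -> : app U F (fun z => (U y z)^*) y = rc (n2 F (U y)).
  by rewrite -sum_rc; apply: eq_bigr => z _; rewrite mulcJ.
have -> : nm F (fun z => (U y z)^*) = nm F (U y).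
  by congr Num.sqrt; apply: eq_bigr => z _; rewrite csqJ.
rewrite mdM mdJ md_rc ger0_norm ?n2_ge0// /(nm [fset x]%fset) n2_1 csq1 sqrtr1 mulr1.
rewrite -nm_sqr; have := nm_ge0 F (U y); set q := nm _ _ => q0 h.
have {}h : q * md (U y x) <= e.
  have [->|qn0] := eqVneq q 0; first by rewrite mul0r ltW.
  have qp : 0 < q by rewrite lt_neqAle eq_sym qn0.
  by rewrite -(ler_pM2l qp) mulrA -expr2 [q * e]mulrC.
have h2 : q ^+ 2 * csq (U y x) <= k * delta.
  rewrite -md_sqr -exprMn -[leRHS]sqr_sqrtr; last by rewrite mulr_ge0// ltW.
  by rewrite ler_pXn2r ?nnegrE ?sqrtr_ge0 ?mulr_ge0 ?md_ge0.
rewrite -(ler_pM2r delta0); apply: le_trans h2.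
by rewrite ler_wpM2l// sqr_ge0.
Qed.

(* If T moves only boundedly far, up to small errors, and <T W_y', W_y> = 1, then the rows
   W_y and W_y' cannot be concentrated around distant points. *)
Lemma rows_controlled U (W : Y -> X -> C) (T : (X -> C) -> X -> C) (K delta : R)
    (E : Y -> Y -> Prop) :
  (forall x y, d x y = d y x) -> (forall x y z, d x z <= d x y + d y z) ->
  orthocols (adj U) -> equi_ql d U -> 0 < delta -> 0 <= K ->
  (forall y x, csq (W y x) = csq (U y x)) ->
  (forall p q M N, l2b p M -> l2b q N -> T (fun x => p x + q x) = (fun x => T p x + T q x)) ->
  (forall v M, l2b v M -> l2b (T v) (K * M)) ->
  (forall e : R, 0 < e -> exists2 r, 0 < r & forall (A : {fset X}) (v : X -> C) M,
     l2b v M -> (forall x z, x \in A -> v z != 0 -> r <= d x z) -> n2 A (T v) <= e * M) ->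
  (forall y y', E y y' -> is_sum (fun x => (W y x)^* * T (W y') x) 1) ->
  exists2 s : R, 0 < s & forall y y' x x', E y y' ->
    delta <= csq (U y x) -> delta <= csq (U y' x') -> d x x' <= s.
Proof.
move=> dC dT oU' eU delta0 K0 WU Tadd Tbd Tql Tsum.
have K1 : 0 < 64 * (K + 1) by rewrite mulr_gt0// ltr_wpDl.
(* Chosen so that [T] maps a tail of squared norm [k] to squared norm at most 1/64. *)
pose k := (64 * (K + 1))^-1; have k0 : 0 < k by rewrite invr_gt0.
have Kk : K * k <= 64^-1.
  rewrite /k invfM mulrCA ler_piMr ?invr_ge0// ler_pdivrMr ?ltr_wpDl// mul1r lerDl//.
have [s s0 hs] := row_concentration eU delta0 k0.
have e64 : 0 < 64^-1 :> R by rewrite invr_gt0.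
have [r r0 hr] := Tql _ e64.
(* Beyond this distance, points within [s] of [x] and points within [s] of [x'] are at least [r]
   apart. *)
exists (s + r + s); first by rewrite !addr_gt0.
move=> y y' x x' Eyy' Uyx Uyx'; rewrite leNgt; apply/negP => lt.
have WUn F z : n2 F (W z) = n2 F (U z) by apply: eq_bigr => t _; exact: WU.
have W1 z : l2b (W z) 1.
  move=> F; rewrite WUn; have := col_bessel F z oU'.
  by rewrite /n2 /adj; under eq_bigr do rewrite csqJ.
pose P z := d z x' < s.
pose p z := if P z then W y' z else 0.
pose q z := if P z then 0 else W y' z.
have pq : W y' = (fun z => p z + q z).
  by apply/funext => z; rewrite /p /q; case: ifP; rewrite ?addr0 ?add0r.
have pb : l2b p 1.
  move=> F; apply: le_trans (W1 y' F); apply: ler_sum => z _; rewrite /p.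
  by case: ifP => // _; rewrite csq0 csq_ge0.
have qb : l2b q k.
  move=> F; have := hs y' x' [fset z in F | ~~ P z]%fset Uyx'.
  move=> /(_ _)/wrap[z|]; first by rewrite !inE /P -leNgt => /andP[].
  rewrite -WUn; apply: le_trans.
  rewrite /n2 (big_fsetID _ P F) /= big1_fset ?add0r; last first.
    by move=> z; rewrite !inE /= => /andP[_ Pz] _; rewrite /q Pz csq0.
  apply: ler_sum => z _; rewrite /q.
  by case: ifP => // _; rewrite csq0 csq_ge0.
have e4 : 0 < 1 / 4 :> R by rewrite divr_gt0.
have [F /(_ F (fsubset_refl _))] := Tsum _ _ Eyy' _ e4.
set u := T (W y').
pose F1 := [fset z in F | d z x < s]%fset; pose F2 := [fset z in F | ~~ (d z x < s)]%fset.
rewrite (big_fsetID _ (fun z => d z x < s) F) /= -/F1 -/F2.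
have nmJ G : nm G (fun z => (W y z)^*) = nm G (W y).
  by congr Num.sqrt; apply: eq_bigr => z _; rewrite csqJ.
have a2 : md (\sum_(z <- F2) (W y z)^* * u z) <= 1 / 8.
  apply: le_trans (cauchy_schwarz _ _ _) _; rewrite nmJ -[leRHS]ger0_norm// -sqrtr_sqr.
  rewrite -sqrtrM ?n2_ge0// ler_wsqrtr//.
  have h1 : n2 F2 (W y) <= k.
    by rewrite WUn; apply: (hs y x) => // z; rewrite !inE -leNgt => /andP[].
  have h2 : n2 F2 u <= K by have := Tbd _ _ (W1 y') F2; rewrite mulr1.
  apply: (@le_trans _ _ (k * K)); first by apply: ler_pM => //; exact: n2_ge0.
  by rewrite mulrC; apply: le_trans Kk _; rewrite expr2; lra.
have a1 : md (\sum_(z <- F1) (W y z)^* * u z) <= 1 / 4.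
  apply: le_trans (cauchy_schwarz _ _ _) _; rewrite nmJ -[leRHS]ger0_norm// -sqrtr_sqr.
  rewrite -sqrtrM ?n2_ge0// ler_wsqrtr//.
  have h1 : n2 F1 (W y) <= 1 by exact: W1.
  have h2 : n2 F1 u <= 16^-1.
    rewrite /u pq (Tadd _ _ _ _ pb qb); apply: le_trans (n2_add _ _ _) _.
    have b1 : n2 F1 (T p) <= 64^-1.
      rewrite -[leRHS]mulr1; apply: hr pb _ => z z'; rewrite !inE => /andP[_ zx].
      rewrite /p; case: ifP => [Pz' _|_]; last by rewrite eqxx.
      have := dT x z x'; have := dT z z' x'; move: zx Pz'; rewrite /P (dC z x).
      by move: lt; lra.
    have b2 : n2 F1 (T q) <= 64^-1 by apply: le_trans Kk; exact: Tbd.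
    by move: b1 b2; lra.
  apply: (@le_trans _ _ (1 * 16^-1)); first by apply: ler_pM => //; exact: n2_ge0.
  by rewrite expr2; lra.
set S1 := \sum_(z <- F1) _ in a1 *; set S2 := \sum_(z <- F2) _ in a2 * => h.
(* Truncation to [F] costs 1/4, the part near [x] 1/4 and the part away from [x] 1/8, less than 1 in
   all. *)
have : md (1 : C) <= 1 / 4 + (1 / 4 + 1 / 8).
  have -> : (1 : C) = - (S1 + S2 - 1) + (S1 + S2) by ring.
  apply: le_trans (mdD _ _) _; rewrite mdN; apply: lerD => //.
  by apply: le_trans (mdD _ _) _; apply: lerD.
by rewrite /md csq1 sqrtr1; lra.
Qed.

End Injection.

Lemma adjK (R : realType) (X Y : choiceType) (U : Y -> X -> R[i]) : adj (adj U) = U.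
Proof. by apply/funext => y; apply/funext => x; rewrite /adj conjcK. Qed.

Section Bijection.
Variables (R : realType) (X Y : choiceType) (dX : X -> X -> R) (dY : Y -> Y -> R).
Local Notation C := (R[i]).
Variable U : Y -> X -> C.
Hypotheses (dXC : forall x y, dX x y = dX y x) (dYC : forall x y, dY x y = dY y x).
Hypotheses (dXT : forall x y z, dX x z <= dX x y + dX y z)
  (dYT : forall x y z, dY x z <= dY x y + dY y z).
Hypotheses (dX0 : forall x, dX x x = 0) (dY0 : forall y, dY y y = 0).
Hypotheses (bX : bounded_geometry dX) (bY : bounded_geometry dY).
Hypotheses (oU : orthocols U) (oU' : orthocols (adj U)).
Hypotheses (eX : equi_ql dX U) (eY : equi_ql dY (adj U)).
Hypothesis ctrlX : forall delta r : R, 0 < delta -> exists2 s : R, 0 < s &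
  forall y y' x x', dY y y' <= r -> delta <= csq (U y x) -> delta <= csq (U y' x') ->
  dX x x' <= s.
Hypothesis ctrlY : forall delta r : R, 0 < delta -> exists2 s : R, 0 < s &
  forall x x' y y', dX x x' <= r -> delta <= csq (U y x) -> delta <= csq (U y' x') ->
  dY y y' <= s.

Theorem controlled_bijection : exists2 b : X -> Y, bijective b &
  (forall r : R, exists2 s : R, 0 < s & forall x x', dX x x' <= r -> dY (b x) (b x') <= s) /\
  (forall r : R, exists2 s : R, 0 < s & forall x x', dY (b x) (b x') <= r -> dX x x' <= s).
Proof.
have [d1 d10 h1] := columns_bounded_below dXC bX oU oU' eX.
have oU2 : orthocols (adj (adj U)) by rewrite adjK.
have [d2 d20 h2] := columns_bounded_below dYC bY oU' oU2 eY.
pose d := Num.min d1 d2; have d0 : 0 < d by rewrite lt_min d10.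
have [f hf] := choice h1; have [g hg] := choice h2.
have {}hf x : d <= csq (adj U x (f x)).
  by rewrite /adj csqJ; apply: le_trans (hf x); rewrite ge_min lexx.
have {}hg y : d <= csq (U y (g y)).
  by have := hg y; rewrite /adj csqJ; apply: le_trans; rewrite ge_min lexx orbT.
have [r r0 [h hi hh]] := injection_near dXC bX oU eX d0 hg.
have [t t0 [k ki kk]] := injection_near dYC bY oU' eY d0 hf.
have [b bb hb] := schroeder_bernstein hi ki.
pose m := Num.max r t.
(* The pair of [x] and [b x] is within [m] of a large entry of [U]: at [g (b x)] and [b x] in one
   case, at [x] and [f x] in the other. The control of large entries thus passes to [b]. *)
have near x : exists x' y', [/\ d <= csq (U y' x'), dX x x' <= m & dY (b x) y' <= m].
  have m0 : 0 <= m by rewrite le_max ltW.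
  have [bx|xk] := hb x.
    exists (g (b x)), (b x); split => //; last by rewrite dY0.
    by rewrite dXC bx le_max hh.
  exists x, (f x); split; [by rewrite -csqJ; exact: hf | by rewrite dX0 |].
  by rewrite dYC {1}xk le_max kk orbT.
exists b => //; split => c.
  have [s s0 hs] := ctrlY (c + m + m) d0.
  exists (m + s + m); first by rewrite !addr_gt0// lt_max r0.
  move=> x x' cx; have [x1 [y1 [u1 a1 b1]]] := near x; have [x2 [y2 [u2 a2 b2]]] := near x'.
  have := hs _ _ _ _ _ u1 u2.
  have -> : dX x1 x2 <= c + m + m.
    by have := dXT x1 x x2; have := dXT x x' x2; rewrite (dXC x1 x); lra.
  move=> /(_ isT); have := dYT (b x) y1 (b x'); have := dYT y1 y2 (b x').
  by rewrite (dYC y2 (b x')); lra.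
have [s s0 hs] := ctrlX (c + m + m) d0.
exists (m + s + m); first by rewrite !addr_gt0// lt_max r0.
move=> x x' cx; have [x1 [y1 [u1 a1 b1]]] := near x; have [x2 [y2 [u2 a2 b2]]] := near x'.
have := hs _ _ _ _ _ u1 u2.
have -> : dY y1 y2 <= c + m + m.
  by have := dYT y1 (b x) y2; have := dYT (b x) (b x') y2; rewrite (dYC y1 (b x)); lra.
move=> /(_ isT); have := dXT x x1 x'; have := dXT x1 x2 x'.
by rewrite (dXC x2 x'); lra.
Qed.

End Bijection.

(** * Operators *)

Section SquareSummable.
Variable X : choiceType.
Implicit Types (v u : X -> C) (F G : {fset X}).

(** [esum] is a supremum over finite sets; this trades extended reals for bounds on finite sums. *)
Lemma l2norm2_leP v (M : R) : (l2norm2 v <= M%:E)%E <-> l2b v M.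
Proof.
split => [h F|h].
  rewrite -lee_fin; apply: le_trans h; rewrite /l2norm2 /n2 -sumEFin.
  apply: ereal_sup_ubound; exists [set` F]%classic; first by split.
  by rewrite fsbig_finite//= set_fsetK.
apply: ge_ereal_sup => _ [A [finA _] <-].
by rewrite fsbig_finite//= sumEFin lee_fin; exact: h.
Qed.

Lemma l2norm2_ge0 v : (0 <= l2norm2 v)%E.
Proof. by apply: esum_ge0 => x _; rewrite lee_fin csq_ge0. Qed.

Lemma l2norm2_fineK v : is_l2 v -> l2norm2 v = (fine (l2norm2 v))%:E.
Proof. by move=> lv; rewrite fineK// ge0_fin_numE// l2norm2_ge0. Qed.

Lemma is_l2_l2b v : is_l2 v -> l2b v (fine (l2norm2 v)).
Proof. by move=> lv; apply/l2norm2_leP; rewrite -l2norm2_fineK. Qed.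

Lemma l2b_is_l2 v M : l2b v M -> is_l2 v.
Proof. by move=> /l2norm2_leP h; apply: le_lt_trans h _; rewrite ltry. Qed.

Lemma l2b_ge0 v M : l2b v M -> 0 <= M.
Proof. by move=> /(_ fset0); apply: le_trans; exact: n2_ge0. Qed.

Lemma l2b_le v M N : M <= N -> l2b v M -> l2b v N.
Proof. by move=> MN h F; apply: le_trans MN. Qed.

Lemma l2b_dom u v M : (forall x, csq (u x) <= csq (v x)) -> l2b v M -> l2b u M.
Proof. by move=> h hv F; apply: le_trans (hv F); apply: ler_sum. Qed.

Lemma l2bD u v M N : l2b u M -> l2b v N ->
  l2b (fun x => u x + v x) (2 * M + 2 * N).
Proof.
move=> hu hv F; apply: le_trans (n2_add _ _ _) _.
by apply: lerD; rewrite ler_pM2l.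
Qed.

Lemma l2bZ (c : C) v M : l2b v M -> l2b (fun x => c * v x) (csq c * M).
Proof. by move=> hv F; rewrite n2_scale ler_wpM2l// csq_ge0. Qed.

Lemma l2b0 : l2b ((fun=> 0) : X -> C) 0.
Proof. by move=> F; rewrite /n2 big1// => x _; rewrite csq0. Qed.

Lemma l2b_chi (A : set X) v M : l2b v M -> l2b (chi A v) M.
Proof. by apply: l2b_dom => x; rewrite /chi; case: ifP => // _; rewrite csq0 csq_ge0. Qed.

Lemma l2b_single (x : X) (c : C) : l2b (fun z => if z == x then c else 0) (csq c).
Proof.
move=> F; have [xF|xF] := boolP (x \in F).
  rewrite /n2 (big_fsetD1 x)//= eqxx big1_fset ?addr0// => z.
  by rewrite !inE => /andP[/negPf -> _] _; rewrite csq0.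
rewrite /n2 big1_fset ?csq_ge0// => z zF _; case: eqP => [zx|_]; last by rewrite csq0.
by move: xF; rewrite -zx zF.
Qed.

Lemma l2_delta (x : X) : is_l2 (delta x).
Proof. exact: l2b_is_l2 (l2b_single x 1). Qed.

Lemma l2D u v : is_l2 u -> is_l2 v -> is_l2 (fun x => u x + v x).
Proof. by move=> /is_l2_l2b hu /is_l2_l2b hv; exact: l2b_is_l2 (l2bD hu hv). Qed.

Lemma l2Z (c : C) v : is_l2 v -> is_l2 (fun x => c * v x).
Proof. by move=> /is_l2_l2b hv; exact: l2b_is_l2 (l2bZ c hv). Qed.

Lemma l2b_tail v M (e : R) : l2b v M -> 0 < e ->
  exists F, forall G, [disjoint G & F] -> n2 G v <= e.
Proof.
move=> hv e0; pose E : set R := [set n2 F v | F in [set: {fset X}]]%classic.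
have supE : has_sup E.
  by split; [exists (n2 fset0 v), fset0 | exists M => _ [F _ <-]; exact: hv].
have [_ [F _ <-] hF] := sup_adherent e0 supE; exists F => G dis.
have : n2 (F `|` G) v <= sup E by apply: ub_le_sup; [case: supE | exists (F `|` G)].
rewrite /n2 (sum_fsetI_D _ _ F) fsetIC fsetKU fsetDUl fsetDv fset0U.
by move/fsetDidPl : dis => ->; move: hF; rewrite /n2; lra.
Qed.

End SquareSummable.

Section BoundedOperators.
Variable X : choiceType.
Implicit Types (a b : Op X) (v u : X -> C).

Lemma bounded_l2b a : is_bounded a ->
  exists2 K : R, 0 <= K & forall v M, l2b v M -> l2b (a v) (K * M).
Proof.
move=> [_ [_ [_ [K hK]]]]; exists (K ^+ 2); first exact: sqr_ge0.
move=> v M hv; apply/l2norm2_leP; apply: le_trans (hK _ (l2b_is_l2 hv)) _.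
by rewrite (EFinM (K ^+ 2) M) lee_wpmul2l// ?lee_fin ?sqr_ge0//; apply/l2norm2_leP.
Qed.

Lemma l2b_bounded a (K : R) : 0 <= K ->
  (forall u v, is_l2 u -> is_l2 v -> a (fun x => u x + v x) = (fun x => a u x + a v x)) ->
  (forall (c : C) v, is_l2 v -> a (fun x => c * v x) = (fun x => c * a v x)) ->
  (forall v M, l2b v M -> l2b (a v) (K * M)) -> is_bounded a.
Proof.
move=> K0 aD aZ aK; split; first by move=> v /is_l2_l2b /aK /l2b_is_l2.
split => //; split => //; exists (Num.sqrt K) => v lv.
rewrite sqr_sqrtr// (l2norm2_fineK lv) -EFinM; apply/l2norm2_leP.
exact/aK/is_l2_l2b.
Qed.

Lemma bounded_l2 a v : is_bounded a -> is_l2 v -> is_l2 (a v).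
Proof. by case => + _; exact. Qed.

Lemma bounded0 a : is_bounded a -> a (fun=> 0) = (fun=> 0).
Proof.
move=> [_ [_ [aZ _]]]; have := aZ 0 _ (l2b_is_l2 (@l2b0 X)).
under eq_fun do rewrite mul0r; move=> ->.
by apply/funext => x; rewrite mul0r.
Qed.

Lemma bounded_sum a (s : seq X) (c : X -> C) : is_bounded a ->
  is_l2 (fun x => \sum_(z <- s) c z * delta z x) /\
  a (fun x => \sum_(z <- s) c z * delta z x) = (fun x => \sum_(z <- s) c z * a (delta z) x).
Proof.
move=> ba; elim: s => [|z s [IHl IHa]].
  under eq_fun do rewrite big_nil; split; first exact: l2b_is_l2 (@l2b0 X).
  by rewrite bounded0//; apply/funext => x; rewrite big_nil.
have lz := l2Z (c z) (l2_delta z).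
under eq_fun do rewrite big_cons; split; first exact: l2D.
have [_ [aD [aZ _]]] := ba; rewrite aD// IHa aZ; last exact: l2_delta.
by apply/funext => x; rewrite big_cons.
Qed.

Lemma sum_delta (F : {fset X}) v x :
  \sum_(z <- F) v z * delta z x = if x \in F then v x else 0.
Proof.
rewrite /delta; case: ifP => xF.
  rewrite (big_fsetD1 x)//= eqxx mulr1 big1_fset ?addr0// => z.
  by rewrite !inE eq_sym => /andP[/negPf -> _] _; rewrite mulr0.
rewrite big1_fset// => z zF _; case: eqP => [xz|_]; last by rewrite mulr0.
by move: xF; rewrite xz zF.
Qed.

(** Continuity: the part of [v] off a large finite set has an image of small norm, so a bounded
    operator is recovered from its matrix. *)
Lemma bounded_is_sum a v x : is_bounded a -> is_l2 v ->
  is_sum (fun z => v z * a (delta z) x) (a v x).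
Proof.
move=> ba lv e e0; have [K K0 hK] := bounded_l2b ba.
have e'0 : 0 < e ^+ 2 / (K + 1) by rewrite divr_gt0 ?exprn_gt0// ltr_wpDl.
have [F0 hF0] := l2b_tail (is_l2_l2b lv) e'0.
exists F0 => F F0F; have [lF aF] := bounded_sum F v ba.
pose q z := if z \in F then 0 else v z.
have qb : l2b q (e ^+ 2 / (K + 1)).
  move=> G; rewrite /n2 (sum_fsetI_D _ G F) big1_fset; last first.
    by move=> z; rewrite !inE => /andP[_ zF] _; rewrite /q zF csq0.
  rewrite add0r; have /hF0 : [disjoint G `\` F & F0].
    apply/fdisjointP => z; rewrite !inE => /andP[zF _].
    by apply: contra zF; exact: (fsubsetP F0F).
  apply: le_trans; rewrite /n2 big_seq [leRHS]big_seq; apply: ler_sum => z.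
  by rewrite !inE /q => /andP[/negPf -> _].
have vE : v = (fun z => (\sum_(t <- F) v t * delta t z) + q z).
  by apply/funext => z; rewrite sum_delta /q; case: ifP; rewrite ?addr0 ?add0r.
have [_ [aD _]] := ba.
have -> : a v x = (\sum_(z <- F) v z * a (delta z) x) + a q x.
  by rewrite [in LHS]vE aD// ?aF//; exact: l2b_is_l2 qb.
rewrite opprD addrA subrr sub0r mdN.
rewrite -(@ler_pXn2r _ 2) ?nnegrE ?md_ge0 ?(ltW e0)// md_sqr.
have := hK _ _ qb [fset x]%fset; rewrite n2_1 => /le_trans; apply.
rewrite mulrCA ler_piMr ?sqr_ge0// ler_pdivrMr ?ltr_wpDl// mul1r lerDl//.
Qed.

Lemma bounded_scale c a : is_bounded a -> is_bounded (op_scale c a).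
Proof.
move=> ba; have [K K0 hK] := bounded_l2b ba; have [_ [aD [aZ _]]] := ba.
apply: (@l2b_bounded _ (csq c * K)%R).
- by rewrite mulr_ge0// csq_ge0.
- by move=> u v lu lv; apply/funext => x; rewrite /op_scale aD// mulrDr.
- by move=> c' v lv; apply/funext => x; rewrite /op_scale aZ// mulrCA.
- by move=> v M hv; rewrite -mulrA; exact/l2bZ/hK.
Qed.

Lemma bounded_mul a b : is_bounded a -> is_bounded b -> is_bounded (op_mul a b).
Proof.
move=> ba bb; have [Ka Ka0 hKa] := bounded_l2b ba; have [Kb Kb0 hKb] := bounded_l2b bb.
have [_ [aD [aZ _]]] := ba; have [bl [bD [bZ _]]] := bb.
apply: (@l2b_bounded _ (Ka * Kb)%R); first by rewrite mulr_ge0.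
- by move=> u v lu lv; rewrite /op_mul bD// aD//; exact: bl.
- by move=> c v lv; rewrite /op_mul bZ// aZ//; exact: bl.
- by move=> v M hv; rewrite -mulrA; exact/hKa/hKb.
Qed.

End BoundedOperators.

Section QuasiLocal.
Variables (X : choiceType) (d : X -> X -> R).
Hypothesis dT : forall x y z, d x z <= d x y + d y z.
Implicit Types (a b : Op X) (v u : X -> C).

(** [l2b] bounds squared norms, whence the square root one way and the square the other; halving [e]
    yields the strict inequality of [opnorm_lt]. *)
Lemma quasi_localP a : quasi_local d a <-> is_bounded a /\
  forall e : R, 0 < e -> exists2 r : R, 0 < r & forall A B : set X,
    (forall x y, A x -> B y -> r <= d x y) ->
    forall v M, l2b v M -> l2b (chi A (a (chi B v))) (e * M).
Proof.
split=> -[ba h]; split => // e e0.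
  have [|r [r0 hr]] := h (Num.sqrt e); first by rewrite sqrtr_gt0.
  exists r => // A B /hr[e' [e'0 [e'e he']]] v M hv.
  apply/l2norm2_leP; apply: le_trans (he' _ (l2b_is_l2 hv)) _.
  rewrite (EFinM e M); apply: lee_pmul; rewrite ?lee_fin ?sqr_ge0 ?l2norm2_ge0//.
    rewrite -[leRHS]sqr_sqrtr ?(ltW e0)// ler_pXn2r ?nnegrE ?sqrtr_ge0//; exact: ltW.
  exact/l2norm2_leP.
have e20 : 0 < (e / 2) ^+ 2 by rewrite exprn_gt0// divr_gt0.
have [r r0 hr] := h _ e20; exists r; split => // A B /hr AB.
exists (e / 2); split; first by rewrite divr_ge0// ltW.
split; first by lra.
move=> v lv; rewrite (l2norm2_fineK lv) -EFinM; apply/l2norm2_leP.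
exact/AB/is_l2_l2b.
Qed.

Lemma chiC_split (A : set X) v : v = (fun x => chi A v x + chi (~` A)%classic v x).
Proof.
apply/funext => x; rewrite /chi; case: asboolP => Ax.
  by rewrite asboolF ?addr0//; exact.
by rewrite asboolT ?add0r.
Qed.

Lemma quasi_local_scale c a : quasi_local d a -> quasi_local d (op_scale c a).
Proof.
move=> /quasi_localP[ba ha]; apply/quasi_localP; split; first exact: bounded_scale.
move=> e e0; have c0 : 0 < csq c + 1 by rewrite ltr_wpDl// csq_ge0.
have [r r0 hr] := ha _ (divr_gt0 e0 c0); exists r => // A B /hr AB v M hv.
have -> : chi A (op_scale c a (chi B v)) = (fun x => c * chi A (a (chi B v)) x).
  by apply/funext => x; rewrite /chi /op_scale; case: ifP => // _; rewrite mulr0.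
apply: l2b_le (l2bZ c (AB v M hv)); rewrite mulrA ler_wpM2r ?(l2b_ge0 hv)//.
by rewrite mulrCA ler_piMr ?(ltW e0)// ler_pdivrMr// mul1r lerDl.
Qed.

Lemma mul_frac_le (K e : R) : 0 <= K -> 0 < e -> K * (e / (4 * (K + 1))) <= e / 4.
Proof.
move=> K0 e0; have K1 : 0 < K + 1 by rewrite ltr_wpDl.
have -> : K * (e / (4 * (K + 1))) = K / (K + 1) * (e / 4) by field; rewrite gt_eqF.
rewrite ler_piMl ?divr_ge0 ?(ltW e0)// ler_pdivrMr//; lra.
Qed.

(** A cut-off at the [r]-neighbourhood [D] of [A] is inserted between the factors: [b] is small from
    [B] to [D], and [a] from the complement of [D] to [A]. *)
Lemma quasi_local_mul a b : quasi_local d a -> quasi_local d b ->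
  quasi_local d (op_mul a b).
Proof.
move=> /quasi_localP[ba ha] /quasi_localP[bb hb]; apply/quasi_localP; split.
  exact: bounded_mul.
have [Ka Ka0 hKa] := bounded_l2b ba; have [Kb Kb0 hKb] := bounded_l2b bb.
move=> e e0.
have Ka1 : 0 < 4 * (Ka + 1) by rewrite mulr_gt0// ltr_wpDl.
have Kb1 : 0 < 4 * (Kb + 1) by rewrite mulr_gt0// ltr_wpDl.
have ea0 := divr_gt0 e0 Kb1; have eb0 := divr_gt0 e0 Ka1.
have [r r0 hr] := ha _ ea0; have [s s0 hs] := hb _ eb0.
exists (r + s); first by rewrite addr_gt0.
move=> A B AB v M hv; have M0 := l2b_ge0 hv.
pose D : set X := [set z | exists2 x, A x & d x z < r]%classic.
have DB x y : D x -> B y -> s <= d x y.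
  by move=> [z Az zx] By; have := AB _ _ Az By; have := dT z x y; lra.
have AD x y : A x -> (~` D)%classic y -> r <= d x y.
  by move=> Ax nD; rewrite leNgt; apply/negP => lt; apply: nD; exists x.
have h1 := hKa _ _ (hs _ _ DB _ _ hv).
have h2 := hr _ _ AD _ _ (hKb _ _ (l2b_chi B hv)).
have [_ [aD _]] := ba.
have lb := l2b_is_l2 (hKb _ _ (l2b_chi B hv)).
have -> : chi A (op_mul a b (chi B v)) = (fun x => chi A (a (chi D (b (chi B v)))) x
    + chi A (a (chi (~` D)%classic (b (chi B v)))) x).
  rewrite /op_mul {1}(chiC_split D (b (chi B v))) aD.
  - by apply/funext => x; rewrite /chi; case: ifP => // _; rewrite addr0.
  - exact: l2b_is_l2 (l2b_chi _ (is_l2_l2b lb)).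
  - exact: l2b_is_l2 (l2b_chi _ (is_l2_l2b lb)).
apply: l2b_le (l2bD (l2b_chi A h1) h2).
have k1 := mul_frac_le Ka0 e0; have k2 := mul_frac_le Kb0 e0.
have := ler_wpM2r M0 k1; have := ler_wpM2r M0 k2; lra.
Qed.

End QuasiLocal.

Section ConcreteOperators.
Variables (X : choiceType) (d : X -> X -> R).

Lemma finite_propagation_ql (a : Op X) (r : R) : is_bounded a ->
  (forall v x, (forall z, d x z <= r -> v z = 0) -> a v x = 0) -> quasi_local d a.
Proof.
(* [r + 1] because propagation reaches distance [r] itself; the maximum ensures positivity. *)
move=> ba prop; split => // e e0; exists (Num.max 1 (r + 1)); split.
  by rewrite lt_max ltr01.
move=> A B AB; exists 0; split => //; split => // v lv.
rewrite /op_mul (_ : chi A (a (chi B v)) = (fun=> 0)); last first.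
  apply/funext => x; rewrite {1}/chi; case: asboolP => // Ax; apply: prop => z xz.
  rewrite /chi asboolF// => Bz; have := AB _ _ Ax Bz.
  by rewrite ge_max => /andP[_]; lra.
apply: (@le_trans _ _ 0%:E); first exact/l2norm2_leP/l2b0.
by rewrite mule_ge0 ?l2norm2_ge0// lee_fin sqr_ge0.
Qed.

Definition munit (x x' : X) : Op X := fun v z => if z == x then v x' else 0.

Lemma munitE x x' v : munit x x' v = (fun z => v x' * delta x z).
Proof. by apply/funext => z; rewrite /munit /delta; case: eqP; rewrite ?mulr1 ?mulr0. Qed.

Lemma munit_bounded x x' : is_bounded (munit x x').
Proof.
apply: (@l2b_bounded _ _ 1) => //.
- by move=> u v _ _; apply/funext => z; rewrite /munit; case: ifP => // _; rewrite addr0.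
- by move=> c v _; apply/funext => z; rewrite /munit; case: ifP => // _; rewrite mulr0.
- move=> v M hv; rewrite mul1r; apply: l2b_le (l2b_single x (v x')).
  by have := hv [fset x']%fset; rewrite n2_1.
Qed.

Lemma munit_ql x x' : quasi_local d (munit x x').
Proof.
apply: (finite_propagation_ql (r := d x x')); first exact: munit_bounded.
by move=> v z h; rewrite /munit; case: eqP => // zx; apply: h; rewrite zx.
Qed.

(** Zero is written as a scalar multiple so that [iso_scale] transports it. *)
Lemma munit_neq0 x :
  ~ op_eq (munit x x) (op_scale 0 (munit x x)).
Proof.
move=> /(_ _ (l2_delta x))/(congr1 (fun f => f x)).
by rewrite /op_scale /munit /delta !eqxx mul0r => /eqP; rewrite oner_eq0.
Qed.

Hypothesis d0 : forall x, d x x = 0.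

Lemma chi_ql (A : set X) : quasi_local d (chi A).
Proof.
apply: (@finite_propagation_ql _ 0); last first.
  by move=> v x h; rewrite /chi; case: ifP => // _; apply: h; rewrite d0.
apply: (@l2b_bounded _ _ 1) => //.
- by move=> u v _ _; apply/funext => z; rewrite /chi; case: ifP => // _; rewrite addr0.
- by move=> c v _; apply/funext => z; rewrite /chi; case: ifP => // _; rewrite mulr0.
- by move=> v M hv; rewrite mul1r; exact: l2b_chi.
Qed.

(* Schur test for the 0-1 matrix of a relation with at most N entries in each row and column. *)
Lemma ball_operator (r : R) : (forall x y, d x y = d y x) -> bounded_geometry d -> 0 < r ->
  exists2 a : Op X, quasi_local d a & forall x x', d x x' <= r -> a (delta x') x = 1.
Proof.
move=> dC bg r0; have [N hN] := balls_fset bg r0; have [b hb] := choice hN.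
exists (fun v x => \sum_(z <- b x) v z); last first.
  move=> x x' xx'; have xb : x' \in b x by apply/(proj1 (hb x)).
  rewrite /delta (big_fsetD1 x')//= eqxx big1_fset ?addr0// => z.
  by rewrite !inE => /andP[/negPf -> _] _.
apply: (@finite_propagation_ql _ r); last first.
  by move=> v x h; rewrite big1_fset// => z /(proj1 (hb x)) xz _; exact: h.
apply: (@l2b_bounded _ _ (N%:R * N%:R)%R); first by rewrite mulr_ge0 ?ler0n.
- by move=> u v _ _; apply/funext => x; rewrite big_split.
- by move=> c v _; apply/funext => x; rewrite mulr_sumr.
move=> v M hv F; have M0 := l2b_ge0 hv.
apply: (@le_trans _ _ (\sum_(x <- F) N%:R * n2 (b x) v)).
  apply: ler_sum => x _; have cs := cauchy_schwarz (b x) (fun=> 1) v.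
  rewrite -(@ler_pXn2r _ 2) ?nnegrE ?md_ge0 ?mulr_ge0 ?nm_ge0// in cs.
  have e1 : \sum_(z <- b x) 1 * v z = \sum_(z <- b x) v z.
    by apply: eq_bigr => z _; rewrite mul1r.
  rewrite exprMn !nm_sqr md_sqr e1 in cs.
  apply: le_trans cs _; rewrite ler_wpM2r ?n2_ge0// /n2.
  under eq_bigr do rewrite csq1.
  by rewrite big_const_seq count_predT iter_addr_0 ler_nat; exact: (proj2 (hb x)).
rewrite -mulr_sumr -mulrA ler_wpM2l ?ler0n//.
pose G := neighbours b F.
apply: (@le_trans _ _ (\sum_(x <- F) \sum_(z <- G) if z \in b x then csq (v z) else 0)).
  rewrite big_seq [leRHS]big_seq; apply: ler_sum => x xF.
  rewrite -big_mkcond /= /n2 big_seq -big_filter -[leRHS]big_filter.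
  rewrite le_eqVlt; apply/orP; left; apply/eqP/perm_big/uniq_perm.
  - by rewrite filter_uniq// fset_uniq.
  - by rewrite filter_uniq// fset_uniq.
  move=> z; rewrite !mem_filter andbb; case zb : (z \in b x) => //=.
  by apply/esym/neighboursP; exists x.
rewrite exchange_big /=.
apply: (@le_trans _ _ (\sum_(z <- G) N%:R * csq (v z))); last first.
  by rewrite -mulr_sumr ler_wpM2l ?ler0n//; exact: hv.
apply: ler_sum => z _; rewrite -big_mkcond /=.
rewrite big_const_seq iter_addr_0 -[leLHS]mulr_natl ler_wpM2r ?csq_ge0// ler_nat.
rewrite -size_filter; apply: leq_trans (proj2 (hb z)).
apply: uniq_leq_size; first by rewrite filter_uniq// fset_uniq.
move=> x; rewrite mem_filter => /andP[/(proj1 (hb x)) xz _].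
by apply/(proj1 (hb z)); rewrite dC.
Qed.

Lemma ql_operator_matrix (a : Op X) : quasi_local d a ->
  ql_matrix d (fun x x' => a (delta x') x).
Proof.
move=> /quasi_localP[ba ha] e e0.
have e20 : 0 < e ^+ 2 by rewrite exprn_gt0.
have [r r0 hr] := ha _ e20; exists r => // A B AB w v.
have [lB aB] := bounded_sum B v ba.
pose vB x := \sum_(z <- B) v z * delta z x; rewrite -/vB in lB aB.
have vBb : l2b vB (n2 B v).
  move=> F; rewrite /n2 (sum_fsetI_D _ F B) [X in _ + X]big1_fset ?addr0; last first.
    by move=> z; rewrite !inE => /andP[/negPf zB _] _; rewrite /vB sum_delta zB csq0.
  apply: le_trans (_ : n2 (F `&` B) v <= _); last first.
    by apply: sum_fsub; [move=> z; exact: csq_ge0 | exact: fsubsetIr].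
  rewrite /n2; apply: ler_sum => z _; rewrite /vB sum_delta.
  by case: ifP => // _; rewrite csq0 csq_ge0.
have := hr [set` A]%classic [set` B]%classic _ _ _ vBb A.
move=> /(_ AB).
have -> : chi [set` B]%classic vB = vB.
  apply/funext => x; rewrite /chi /vB sum_delta; case: asboolP => //= xB.
  by case: ifP => // /xB.
have -> : n2 A (chi [set` A]%classic (a vB)) = n2 A (a vB).
  by apply: eq_big_seq => x xA; rewrite /chi asboolT.
move=> nA.
have -> : \sum_(x <- A) \sum_(x' <- B) (w x)^* * v x' * a (delta x') x =
    \sum_(x <- A) (w x)^* * a vB x.
  apply: eq_bigr => x _; rewrite aB mulr_sumr; apply: eq_bigr => z _.
  by rewrite mulrA.
apply: le_trans (cauchy_schwarz _ _ _) _.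
have -> : nm A (fun x => (w x)^*) = nm A w.
  by congr Num.sqrt; apply: eq_bigr => z _; rewrite csqJ.
rewrite mulrAC mulrC ler_wpM2r ?nm_ge0//.
rewrite -(@ler_pXn2r _ 2) ?nnegrE ?nm_ge0 ?mulr_ge0 ?nm_ge0 ?(ltW e0)//.
by rewrite exprMn !nm_sqr.
Qed.

End ConcreteOperators.

(** * Spatial implementation *)

(** Stable under inversion, by [mul_iso_inverse]. Adjoints are kept apart: for the inverse they are
    recovered on matrix units from the entries of U. *)
Record mul_iso (X Y : choiceType) (dX : X -> X -> R) (dY : Y -> Y -> R)
    (phi : Op X -> Op Y) : Prop := MulIso {
  iso_ql : forall a, quasi_local dX a -> quasi_local dY (phi a);
  iso_eq : forall a b, quasi_local dX a -> quasi_local dX b ->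
    op_eq a b -> op_eq (phi a) (phi b);
  iso_inj : forall a b, quasi_local dX a -> quasi_local dX b ->
    op_eq (phi a) (phi b) -> op_eq a b;
  iso_surj : forall b, quasi_local dY b -> exists2 a, quasi_local dX a & op_eq (phi a) b;
  iso_scale : forall (c : C) a, quasi_local dX a ->
    op_eq (phi (op_scale c a)) (op_scale c (phi a));
  iso_mul : forall a b, quasi_local dX a -> quasi_local dX b ->
    op_eq (phi (op_mul a b)) (op_mul (phi a) (phi b)) }.

(* The columns of U are the images xi_x of the basis vectors delta_x, and a_{x x'} =
   <phi(a) xi_{x'}, xi_x> says that phi is conjugation by U. *)
Definition implemented (X Y : choiceType) (dX : X -> X -> R) (phi : Op X -> Op Y)
    (U : Y -> X -> C) :=
  (forall x, is_l2 (U^~ x)) /\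
  forall a, quasi_local dX a -> forall x x',
    is_sum (fun y => (U y x)^* * phi a (U^~ x') y) (a (delta x') x).

Section Spatial.
Variables (X Y : choiceType) (dX : X -> X -> R) (dY : Y -> Y -> R) (phi : Op X -> Op Y).
Hypothesis dXT : forall x y z, dX x z <= dX x y + dX y z.
Hypothesis iso : mul_iso dX dY phi.
Hypothesis adjM : forall x x', is_adjoint (phi (munit x x')) (phi (munit x' x)).
Variable x0 : X.
Let E x x' := phi (munit x x').
Let P := E x0 x0.

Let Eql x x' : quasi_local dY (E x x').
Proof. exact: (iso_ql iso) (munit_ql _ _ _). Qed.

Let Eb x x' : is_bounded (E x x'). Proof. by case: (Eql x x'). Qed.

Let EJ x x' y y' : E x x' (delta y') y = (E x' x (delta y) y')^*.
Proof. exact: adjM. Qed.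

Let PJ y y' : P (delta y') y = (P (delta y) y')^*.
Proof. exact: EJ. Qed.

Let EE x z x' v : is_l2 v -> E x z (E z x' v) = E x x' v.
Proof.
move=> lv; rewrite /E; have <- : op_mul (munit x z) (munit z x') = munit x x'.
  by apply/funext => u; apply/funext => t; rewrite /op_mul /munit eqxx.
by rewrite (iso_mul iso)//; exact: munit_ql.
Qed.

(** Transport of e_{x0 x} a e_{x' x0} = a_{x x'} e_{x0 x0}, which makes the entries of [a] visible
    in [phi a]. *)
Let sandwich a x x' v : quasi_local dX a -> is_l2 v ->
  E x0 x (phi a (E x' x0 v)) = (fun t => a (delta x') x * P v t).
Proof.
move=> qa lv.
have q1 := quasi_local_mul dXT qa (munit_ql dX x' x0).
have q2 := quasi_local_mul dXT (munit_ql dX x0 x) q1.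
have q3 := quasi_local_scale (a (delta x') x) (munit_ql dX x0 x0).
have e : op_eq (op_mul (munit x0 x) (op_mul a (munit x' x0)))
    (op_scale (a (delta x') x) (munit x0 x0)).
  move=> u lu; apply/funext => z; rewrite /op_mul /op_scale (munitE x').
  have [[_ [_ [aZ _]]] _] := qa; rewrite aZ; last exact: l2_delta.
  by rewrite /munit; case: eqP => _; rewrite ?mulr0// mulrC.
have := iso_eq iso q2 q3 e lv.
rewrite (iso_mul iso (munit_ql _ _ _) q1 lv) (iso_scale iso _ (munit_ql _ _ _) lv).
by rewrite /op_mul (iso_mul iso qa (munit_ql _ _ _) lv).
Qed.

Let P_nonzero : exists v t, is_l2 v /\ P v t != 0.
Proof.
apply: contrapT => h.
have P0 : op_eq P (op_scale 0 P).
  move=> v lv; apply/funext => t; rewrite /op_scale mul0r.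
  by apply: contrapT => /eqP ne; apply: h; exists v, t.
have q := munit_ql dX x0 x0.
apply: (@munit_neq0 _ x0); apply: (iso_inj iso q (quasi_local_scale 0 q)) => v lv.
by rewrite (iso_scale iso _ q lv); exact: P0.
Qed.

(** [sandwich] at a preimage of a matrix unit of [Y]: every P e_{y y'} P is a multiple of [P], which
    forces rank one. *)
Let rank_one y y' : exists c : C, forall v u, is_l2 v ->
  P v y' * P (delta y) u = c * P v u.
Proof.
have [a qa ha] := iso_surj iso (munit_ql dY y y').
exists (a (delta x0) x0) => v u lv.
have := sandwich x0 x0 qa lv; rewrite -/P ha; last exact: bounded_l2 (Eb _ _) lv.
rewrite munitE; have [_ [_ [PZ _]]] : is_bounded P := Eb x0 x0; rewrite PZ; last exact: l2_delta.
by move=> /(congr1 (fun f => f u)).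
Qed.

(** By [rank_one] the squared modulus of a nonzero entry at z, t is the product of the diagonal
    entries at z and t. *)
Let P_diag : exists t, P (delta t) t != 0.
Proof.
have [v [t [lv nz]]] := P_nonzero.
have [z nzz] : exists z, P (delta z) t != 0.
  apply: contrapT => h; move/eqP: nz; apply.
  apply: is_sum_unique (bounded_is_sum t (Eb x0 x0) lv) _.
  apply: is_sum_eq (@is_sum0 _ _) => z.
  suff -> : E x0 x0 (delta z) t = 0 by rewrite mulr0.
  by apply: contrapT => /eqP ne; apply: h; exists z.
have [c hc] := rank_one z t; exists t.
have ce : c = P (delta z) t by apply: (mulIf nzz); rewrite -hc//; exact: l2_delta.
have := hc (delta t) z (l2_delta t); rewrite ce => h.
apply/eqP => p0; move/eqP: h; rewrite p0 mul0r eq_sym mulf_eq0 (negPf nzz) /=.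
by rewrite PJ conjc_eq0 (negPf nzz).
Qed.

(** [P] is a self-adjoint idempotent, so [rho] is the squared norm of [P (delta t)]; column [x] of
    [U] is the image under [E x x0] of that vector normalised. *)
Lemma spatial : exists U : Y -> X -> C, implemented dX phi U /\
  forall x x' y y', phi (munit x x') (delta y') y = U y x * (U y' x')^*.
Proof.
have [t tnz] := P_diag; pose rho := P (delta t) t.
have ld := l2_delta t.
have R1 v u : is_l2 v -> rho * P v u = P v t * P (delta t) u.
  move=> lv; have [c hc] := rank_one t t; rewrite hc//; congr (_ * _).
  by apply: (mulIf tnz); rewrite -hc.
pose al := complex.Re rho.
have rhoE : rho = rc al.
  by apply: conj_fix_real; exact: PJ.
have al0 : 0 < al.
  have : is_sum (fun z => rc (csq (P (delta t) z)) : C) (rc al).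
    rewrite -rhoE; have := bounded_is_sum t (Eb x0 x0) (bounded_l2 (Eb x0 x0) ld).
    rewrite EE//; apply: is_sum_eq => z.
    by rewrite (EJ x0 x0 t z) mulcJ.
  move=> /(is_sum_ub fset0 (fun z => csq_ge0 _)); rewrite big_seq_fset0.
  rewrite le_eqVlt => /orP[/eqP a0|//]; move: tnz; rewrite -/rho rhoE -a0.
  by rewrite eqxx.
pose be := Num.sqrt al; have be0 : 0 < be by rewrite sqrtr_gt0.
have beJ : (rc be : C)^* = rc be by rewrite conjc_real.
have be2 : rc be * rc be = rho by rewrite rhoE -rmorphM /= -expr2 sqr_sqrtr// ltW.
have benz : rc be != 0 :> C.
  by apply/eqP => /(congr1 (@complex.Re _)) b0; move: be0; rewrite (b0 : be = 0) ltxx.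
pose U y x := (rc be)^-1 * E x x0 (delta t) y.
have EU x y : E x x0 (delta t) y = rc be * U y x by rewrite /U mulVKf.
have lU x : is_l2 (U^~ x) by apply: l2Z; apply: bounded_l2 ld; exact: Eb.
exists U; split; first split => // a qa x x'.
  have qphi := iso_ql iso qa.
  have := congr1 (fun f => f t) (sandwich x x' qa ld); rewrite -/rho => h.
  have lE := bounded_l2 (Eb x' x0) ld.
  have lA := bounded_l2 (proj1 qphi) lE.
  have := is_sumZ rho^-1 (bounded_is_sum t (Eb x0 x) lA).
  rewrite h mulrCA mulVf// mulr1; apply: is_sum_eq => y.
  rewrite (EJ x0 x t y) EU.
  have -> : E x' x0 (delta t) = (fun y => rc be * U y x') by apply/funext => z; rewrite EU.
  have [[_ [_ [aZ _]]] _] := qphi; rewrite aZ//.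
  rewrite conjM beJ -be2; field; exact: benz.
move=> x x' y y'; have ly := l2_delta y'.
rewrite -/(E x x') -(EE x x0 x' ly).
pose v := E x0 x' (delta y'); have lv : is_l2 v by exact: bounded_l2 (Eb _ _) ly.
have Pv : P v = v by rewrite /P /v EE.
have vE : v = (fun u => rho^-1 * v t * P (delta t) u).
  by apply/funext => u; rewrite -mulrA -[in X in _ * (X * _)]Pv -R1// Pv mulKf.
rewrite -/v vE; have [_ [_ [EZ _]]] := Eb x x0.
rewrite EZ; last exact: bounded_l2 (Eb _ _) ld.
rewrite EE// EU /v (EJ x0 x' t y') EU conjM beJ -be2.
by field; exact: benz.
Qed.

End Spatial.

(** * Rigidity *)

Lemma op_eq_sym (X : choiceType) (a b : Op X) : op_eq a b -> op_eq b a.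
Proof. by move=> h v lv; rewrite h. Qed.

Lemma op_eq_trans (X : choiceType) (a b c : Op X) : op_eq a b -> op_eq b c -> op_eq a c.
Proof. by move=> h h' v lv; rewrite h// h'. Qed.

Lemma mul_iso_inverse (X Y : choiceType) (dX : X -> X -> R) (dY : Y -> Y -> R)
    (phi : Op X -> Op Y) :
  (forall x y z, dX x z <= dX x y + dX y z) -> (forall x y z, dY x z <= dY x y + dY y z) ->
  mul_iso dX dY phi ->
  exists psi : Op Y -> Op X, [/\ mul_iso dY dX psi,
    forall b, quasi_local dY b -> op_eq (phi (psi b)) b &
    forall a, quasi_local dX a -> op_eq (psi (phi a)) a].
Proof.
move=> dXT dYT iso.
(* [choice] needs a total relation; the identity is the default off the quasi-local operators. *)
have ex b : exists a, quasi_local dY b -> quasi_local dX a /\ op_eq (phi a) b.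
  have [qb|nb] := pselect (quasi_local dY b); last by exists (fun v => v).
  by have [a qa ab] := iso_surj iso qb; exists a.
have [psi hpsi] := choice ex.
have pq b : quasi_local dY b -> quasi_local dX (psi b) by move=> /hpsi[].
have pK b : quasi_local dY b -> op_eq (phi (psi b)) b by move=> /hpsi[].
have Kp a : quasi_local dX a -> op_eq (psi (phi a)) a.
  move=> qa; have qpa := iso_ql iso qa.
  by apply: (iso_inj iso) => //; [exact: pq | exact: pK].
exists psi; split => //; split => //.
- move=> a b qa qb ab; apply: (iso_inj iso); [exact: pq | exact: pq |].
  exact: op_eq_trans (pK _ qa) (op_eq_trans ab (op_eq_sym (pK _ qb))).
- move=> a b qa qb ab; apply: op_eq_trans (op_eq_sym (pK _ qa)) _.
  by apply: op_eq_trans (pK _ qb); apply: (iso_eq iso) => //; exact: pq.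
- by move=> a qa; exists (phi a); [exact: iso_ql iso _ qa | exact: Kp].
- move=> c a qa; have qc := quasi_local_scale c qa; have qpa := pq _ qa.
  apply: (iso_inj iso); [exact: pq | exact: quasi_local_scale |].
  apply: op_eq_trans (pK _ qc) _; apply: op_eq_sym.
  apply: op_eq_trans (iso_scale iso c qpa) _ => v lv.
  by rewrite /op_scale (pK _ qa v lv).
- move=> a b qa qb; have qc := quasi_local_mul dYT qa qb.
  have qpa := pq _ qa; have qpb := pq _ qb.
  apply: (iso_inj iso); [exact: pq | exact: quasi_local_mul |].
  apply: op_eq_trans (pK _ qc) _; apply: op_eq_sym.
  apply: op_eq_trans (iso_mul iso qpa qpb) _ => v lv.
  rewrite /op_mul (pK _ qb v lv) (pK _ qa)//.
  by apply: bounded_l2 lv; case: qb.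
Qed.

Section OneSide.
Variables (X Y : choiceType) (dX : X -> X -> R) (dY : Y -> Y -> R).
Variables (phi : Op X -> Op Y) (psi : Op Y -> Op X) (U Z : Y -> X -> C) (V : X -> Y -> C).
Hypotheses (dXC : forall x y, dX x y = dX y x) (dYC : forall x y, dY x y = dY y x).
Hypothesis dXT : forall x y z, dX x z <= dX x y + dX y z.
Hypotheses (dX0 : forall x, dX x x = 0) (dY0 : forall y, dY y y = 0).
Hypothesis bY : bounded_geometry dY.
Hypotheses (isoX : mul_iso dX dY phi) (isoY : mul_iso dY dX psi).
Hypothesis pK : forall b, quasi_local dY b -> op_eq (phi (psi b)) b.
Hypotheses (impX : implemented dX phi U) (impY : implemented dY psi V).
Hypotheses (ZU : forall y x x', (Z y x)^* * Z y x' = (U y x)^* * U y x')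
  (ZV : forall y x, csq (Z y x) = csq (V x y)).

(** The cut-off by [B] has the matrix of [psi (chi B)], which is quasi-local. [Z] is [U] itself in
    one application; in the other, with the spaces exchanged, it is the adjoint of the matrix of
    [phi] and agrees with the implementing matrix up to a phase, hence the form of [ZU] and [ZV]. *)
Lemma implemented_cutoffs : ql_cutoffs dX Z.
Proof.
move=> B; have qB := chi_ql dY0 B; have qp := iso_ql isoY qB.
exists (fun x x' => psi (chi B) (delta x') x); first exact: ql_operator_matrix.
move=> x x'; have [lU /(_ _ qp x x')] := impX.
apply: is_sum_eq => y; rewrite pK// /chi.
by case: ifP => _; rewrite ?mulr0// ZU.
Qed.

Lemma implemented_orthocols : orthocols Z.
Proof.
move=> x x'; pose one : Op X := chi setT.
have qone : quasi_local dX one by exact: chi_ql.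
have oneE v : one v = v by apply/funext => z; rewrite /one /chi asboolT.
(* If [phi a] is the identity, then [phi one] = [phi one] [phi a] = [phi (op_mul one a)] =
   [phi a]. *)
have phi1 : op_eq (phi one) (fun v => v).
  move=> v lv; have qoneY : quasi_local dY (chi setT) by exact: chi_ql.
  have [a qa ha] := iso_surj isoX qoneY.
  have e : op_mul one a = a by apply/funext => u; exact: oneE.
  have vE : phi a v = v by rewrite ha//; apply/funext => z; rewrite /chi asboolT.
  by have := iso_mul isoX qone qa lv; rewrite e /op_mul vE => <-.
have [lU /(_ _ qone x x')] := impX; rewrite oneE /delta.
have -> : (if x == x' then 1 else 0) = (x == x')%:R :> C by case: eqP.
by apply: is_sum_eq => y; rewrite phi1// ZU.
Qed.

Lemma implemented_equi_ql : equi_ql dX Z.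
Proof. exact: equi_quasi_local implemented_orthocols implemented_cutoffs. Qed.

(** The coefficient of [psi a] between columns [y] and [y'] of [V] is the entry of [a] there, which
    is 1 for the ball operator. *)
Lemma implemented_rows_controlled (delta r : R) : orthocols (adj Z) -> 0 < delta ->
  exists2 s : R, 0 < s & forall y y' x x', dY y y' <= r ->
    delta <= csq (Z y x) -> delta <= csq (Z y' x') -> dX x x' <= s.
Proof.
move=> oZ' delta0; have r0 : 0 < Num.max 1 r by rewrite lt_max ltr01.
have [a qa ha] := ball_operator dYC bY r0.
have qp := iso_ql isoY qa; have /quasi_localP[bp hp] := qp.
have [K K0 hK] := bounded_l2b bp.
have [lV hV] := impY.
apply: (@rows_controlled _ _ _ dX Z (fun y x => V x y) (psi a) K delta
  (fun y y' => dY y y' <= r)) => //.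
- exact: implemented_equi_ql.
- move=> p q M N hp' hq; have [_ [aD _]] := bp.
  by rewrite aD//; [exact: l2b_is_l2 hp' | exact: l2b_is_l2 hq].
- move=> e e0; have [s s0 hs] := hp _ e0; exists s => // A v M hv AB.
  pose B : set X := [set z | v z != 0]%classic.
  have vB : chi B v = v.
    by apply/funext => z; rewrite /chi; case: asboolP => // /negP; rewrite negbK => /eqP.
  have := hs [set` A]%classic B (fun x z xA zB => AB x z xA zB) _ _ hv A.
  rewrite vB; apply: le_trans; rewrite /n2 le_eqVlt; apply/orP; left; apply/eqP.
  by apply: eq_big_seq => x xA; rewrite /chi asboolT.
- move=> y y' yy'; rewrite -(ha y y'); first exact: hV.
  by rewrite le_max yy' orbT.
Qed.

End OneSide.

Section Rigidity.
Variables (X Y : choiceType) (dX : X -> X -> R) (dY : Y -> Y -> R).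
Hypotheses (mX : is_metric dX) (mY : is_metric dY) (uX : ulf dX) (uY : ulf dY).
Variable phi : Op X -> Op Y.
Hypothesis iso : mul_iso dX dY phi.
Hypothesis adjM : forall x x', is_adjoint (phi (munit x x')) (phi (munit x' x)).

Lemma rigidity_pointed (x0 : X) (y0 : Y) : bij_coarse_equiv dX dY.
Proof.
have [_ [dX0 [dXC dXT]]] := mX; have [_ [dY0 [dYC dYT]]] := mY.
have {}dX0 x : dX x x = 0 by apply/dX0.
have {}dY0 y : dY y y = 0 by apply/dY0.
have bX : bounded_geometry dX := uX; have bY : bounded_geometry dY := uY.
have [U [impX _]] := spatial dXT iso adjM x0.
have [psi [isoY pK Kp]] := mul_iso_inverse dXT dYT iso.
(* [spatial] will express the same entries through V; the comparison [UV] says that V is U^* up to a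
   phase. *)
have psiM y y' x x' : psi (munit y y') (delta x') x = (U y x)^* * U y' x'.
  have qm := munit_ql dY y y'; have [lU /(_ _ (iso_ql isoY qm) x x') h] := impX.
  apply: is_sum_unique h _; apply: is_sum_eq (is_sum_single (fun z => (U z x)^* * U y' x') y) => z.
  rewrite pK// /munit; case: asboolP => [->|]; first by rewrite eqxx.
  by case: eqP => // _ _; rewrite mulr0.
have adjN y y' : is_adjoint (psi (munit y y')) (psi (munit y' y)).
  by move=> x x'; rewrite !psiM conjM conjcK mulrC.
have [V [impY hV]] := spatial dYT isoY adjN y0.
have UV x x' y y' : V x y * (V x' y')^* = (U y x)^* * U y' x' by rewrite -hV psiM.
have cUV y x : csq (U y x) = csq (V x y).
  by apply: (@complexI R); rewrite -mulJc -mulcJ UV.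
have UV' x y y' : (adj U x y)^* * adj U x y' = (V x y)^* * V x y'.
  by rewrite /adj conjcK -[RHS]conjcK conjM conjcK UV conjM conjcK.
have cUV' x y : csq (adj U x y) = csq (U y x) by rewrite /adj csqJ.
have oU : orthocols U by exact: (implemented_orthocols dX0 dY0 iso impX).
have oU' : orthocols (adj U) by exact: (implemented_orthocols dY0 dX0 isoY impY UV').
have eX : equi_ql dX U by exact: (implemented_equi_ql dX0 dY0 iso isoY pK impX).
have eY : equi_ql dY (adj U) by exact: (implemented_equi_ql dY0 dX0 isoY iso Kp impY UV').
have oU2 : orthocols (adj (adj U)) by rewrite adjK.
have ctrlX (delta r : R) (delta0 : 0 < delta) := implemented_rows_controlled dXC dYC dXT
  dX0 dY0 bY iso isoY pK impX impY (fun _ _ _ => erefl) cUV r oU' delta0.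
have ctrlY (delta r : R) (delta0 : 0 < delta) := implemented_rows_controlled dYC dXC dYT
  dY0 dX0 bX isoY iso Kp impY impX UV' cUV' r oU2 delta0.
have [||b bb [b1 b2]] := controlled_bijection dXC dYC dXT dYT dX0 dY0 bX bY oU oU' eX eY.
- by move=> delta r /(ctrlX delta r).
- move=> delta r /(ctrlY delta r)[s s0 hs]; exists s => // x x' y y'.
  by have := hs x x' y y'; rewrite !cUV'.
exists b; split => //; split.
  by move=> r _; have [s s0 hs] := b1 r; exists s.
have [g bg gb] := bb; exists g; split.
  by move=> r _; have [s s0 hs] := b2 r; exists s; split => // y y' yy'; apply: hs; rewrite !gb.
split; first by exists 0 => y; rewrite /= gb dY0.
by exists 0 => x; rewrite /= bg dX0.
Qed.

(** [spatial] needs base points. If just one space is empty, a matrix unit of the other would be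
    zero; if both are, the empty map works. *)
Lemma rigidity : bij_coarse_equiv dX dY.
Proof.
have [[x0 _]|nX] := pselect (exists x : X, True).
  have [[y0 _]|nY] := pselect (exists y : Y, True); first exact: rigidity_pointed x0 y0.
  exfalso; apply: (@munit_neq0 _ x0).
  apply: (iso_inj iso); [exact: munit_ql | exact/quasi_local_scale/munit_ql |].
  by move=> v _; apply/funext => y; exfalso; apply: nY; exists y.
have nY (y : Y) : False.
  have [a qa ha] := iso_surj iso (munit_ql dY y y).
  apply: (@munit_neq0 _ y) => v lv.
  have -> : op_scale 0 (munit y y) v = op_scale 0 (phi a) v by rewrite /op_scale ha.
  rewrite -(iso_scale iso 0 qa lv) -(ha _ lv).
  congr (phi _ v); apply/funext => u; apply/funext => x.
  by exfalso; apply: nX; exists x.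
have {}nX (x : X) : False by apply: nX; exists x.
pose f (x : X) : Y := False_rect Y (nX x); pose g (y : Y) : X := False_rect X (nY y).
exists f; split; first by exists g => [x|y]; [case: (nX x) | case: (nY y)].
split; first by move=> r r0; exists 1; split => // x; case: (nX x).
exists g; split; first by move=> r r0; exists 1; split => // y; case: (nY y).
by split; exists 0; [move=> y; case: (nY y) | move=> x; case: (nX x)].
Qed.

End Rigidity.

Theorem theorem3p2 (X Y : choiceType) (dX : X -> X -> R) (dY : Y -> Y -> R) :
  is_metric dX -> is_metric dY -> ulf dX -> ulf dY ->
  (exists phi : Op X -> Op Y, star_iso_ql dX dY phi) ->
  bij_coarse_equiv dX dY.
Proof.
move=> mX mY uX uY [phi [h1 [h2 [h3 [h4 [_ [h6 [h7 h8]]]]]]]].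
have iso : mul_iso dX dY phi.
  by split => // b /h4[a [qa ab]]; exists a.
apply: (rigidity mX mY uX uY iso) => x x'; apply: h8; try exact: munit_ql.
move=> z z'; rewrite /munit /delta [x' == z']eq_sym [x == z]eq_sym.
by case: (z == x); case: (z' == x'); rewrite ?conjc1 ?conjc0.
Qed.
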